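(* Let $p$ be a prime number, let $X \subset \mathbb{C}_p$ be an analytic space and let $f : X \to \mathbb{C}_p$ be a non-constant holomorphic function. Then $f$ is injective if and only if $$\left| \frac{f(x) - f(y)}{x - y} \right|^2 = |f'(x) \cdot f'(y)| \quad \text{for all distinct } x, y \in X.$$
   Context: $\mathbb{Q}_p$ is the field of $p$-adic numbers, $\mathbb{C}_p$ is the smallest algebraically closed and complete extension of $\mathbb{Q}_p$, $|\cdot|$ is its norm, and $|\mathbb{C}_p^*| = \{|z| : z \in \mathbb{C}_p, z \neq 0\}$. A closed (resp. open) ball of $\mathbb{C}_p$ is a set $\{z \in \mathbb{C}_p : |z-a| \le r\}$ (resp. $\{z \in \mathbb{C}_p : |z-a| < r\}$) with $a \in \mathbb{C}_p$ and $r \in |\mathbb{C}_p^*|$. A (closed) affinoid is a set of the form $B - (B_1 \cup \dots \cup B_n)$, where $B$ is a closed ball and $B_1, \dots, B_n$ are open balls. An analytic space (subset of $\mathbb{C}_p$) is an increasing union of affinoids. A holomorphic function on an affinoid is a uniform limit (on the affinoid) of rational functions in $\mathbb{C}_p(z)$ without poles in the affinoid. A holomorphic function on an analytic space $X$ is a function $f: X \to \mathbb{C}_p$ whose restriction to every affinoid contained in $X$ is holomorphic. $f'$ denotes the derivative of $f$. *)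

(* Defs.v *)
From HB Require Import structures.
From mathcomp Require Import all_boot all_order all_algebra.
From mathcomp Require Import all_classical all_reals.
From mathcomp Require Import topology.

Set Implicit Arguments.
Unset Strict Implicit.
Unset Printing Implicit Defensive.

Import Order.TTheory GRing.Theory Num.Theory.

Local Open Scope classical_set_scope.
Local Open Scope ring_scope.

(* The library's normed modules cannot be used here: the axiom
   `|x *+ n| = `|x| *+ n of normedZmodType fails for ultrametric norms. The
   norm is therefore a separate function, tied to the metric structure of the
   library by ball_cnorm. *)
HB.mixin Record isUltranormed (R : realType) K
    of GRing.Field K & PseudoMetric R K := {
  cnorm : K -> R ;
  cnorm_ge0 : forall x, 0 <= cnorm x ;
  cnorm_eq0 : forall x, cnorm x = 0 -> x = 0 ;
  cnormM : forall x y, cnorm (x * y) = cnorm x * cnorm y ;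
  cnormD : forall x y, cnorm (x + y) <= Num.max (cnorm x) (cnorm y) ;
  ball_cnorm : ball = ball_ cnorm
}.

#[short(type="ultraClosedFieldType")]
HB.structure Definition UltraClosedField (R : realType) :=
  {K of GRing.ClosedField K & CompletePseudoMetric R K & isUltranormed R K}.

Section Cp.
Variables (R : realType) (K : ultraClosedFieldType R).
Implicit Types (S : {pred K}) (A B X : set K) (f : K -> K).

Definition padic_norm (p : nat) (q : rat) : R :=
  if q == 0 then 0
  else p%:R ^+ logn p `|denq q|%N / p%:R ^+ logn p `|numq q|%N.

(* As K is complete, the closure of its prime field is the completion of rat
   for the restricted norm; this is Q_p when that norm is padic_norm p. *)
Definition Qp : set K := closure (range (ratr : rat -> K)).

Definition alg_closed S :=
  forall P : {poly K}, P \is a polyOver S -> (1 < size P)%N ->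
    exists2 x, x \in S & root P x.

Definition complete_in S :=
  forall u : nat -> K, (forall n, u n \in S) -> cauchy (u @ \oo) ->
    exists2 l, l \in S & u @ \oo --> l.

(* K, which is algebraically closed and complete by its type, is an extension
   of Q_p as a normed field, and no proper subfield containing Q_p is both
   algebraically closed and complete. This determines K up to isometric
   isomorphism. *)
Definition is_Cp (p : nat) :=
  (forall q : rat, cnorm (ratr q : K) = padic_norm p q) /\
  (forall S, GRing.divring_closed S -> Qp `<=` [set` S] ->
     alg_closed S -> complete_in S -> [set` S] = setT).

Definition value_group : set R := [set cnorm z | z in [set z : K | z != 0]].

Definition closed_ball_Cp B :=
  exists (a : K) (r : R), value_group r /\ B = [set z | cnorm (z - a) <= r].

Definition open_ball_Cp B :=
  exists (a : K) (r : R), value_group r /\ B = [set z | cnorm (z - a) < r].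

Definition affinoid A :=
  exists (B : set K) (n : nat) (Bs : 'I_n -> set K),
    [/\ closed_ball_Cp B, forall i, open_ball_Cp (Bs i) &
        A = B `\` \bigcup_i Bs i].

Definition analytic_space X :=
  exists An : nat -> set K,
    [/\ forall n, affinoid (An n),
        {homo An : m n / (m <= n)%N >-> m `<=` n} &
        X = \bigcup_n An n].

(* A rational function has no pole in A iff it has a denominator without
   zeros in A. *)
Definition rational_on A f :=
  exists P Q : {poly K},
    forall z, A z -> Q.[z] != 0 /\ f z = P.[z] / Q.[z].

(* Functions on a subset of K are total functions of which only the values on
   the subset matter. *)
Definition holomorphic_on_affinoid A f :=
  exists g : nat -> K -> K,
    (forall n, rational_on A (g n)) /\ {uniform A, g @ \oo --> f}.

Definition holomorphic X f :=
  forall A, affinoid A -> A `<=` X -> holomorphic_on_affinoid A f.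

(* At a point of an analytic space X this depends only on f on X, since X is
   open. *)
Definition deriv_Cp f (x : K) : K :=
  lim ((fun h => (f (x + h) - f x) / h) @ (0 : K)^').

End Cp.

Arguments is_Cp {R} K p.

(* Main.v *)
Require Import Defs.
From mathcomp Require Import all_boot all_order all_algebra.
From mathcomp Require Import all_classical all_reals.
From mathcomp Require Import topology interval_inference.
From mathcomp Require Import ring lra.

(** If f takes the same value at two points of X, the equation makes one of
    the two derivatives vanish, and then f is constant by the equation again.

    Conversely let f be injective on an affinoid A. For y in A the divided
    difference h_y(x) = (f x - f y) / (x - y), with h_y(y) = f'(y), is a
    uniform limit of rational functions without zeros in A; characteristic 0
    is needed for f'(y) <> 0. Zeros of approximants converge to zeros of the
    limit, so |h_y| is locally given by Gauss norms of rational functions: it is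
    constant on the open discs of A, equal on residue classes of a common
    circle, and an integral power of |x - a| on annuli centred at a.
    The function M(x, y) = |h_y(x)| is symmetric and has this behaviour in both
    variables. On a product of two annuli, log M is affine in each logarithmic
    radius with integral slopes, and the slopes, varying affinely on a dense
    set, are constant. As the points of A are linked by circles and annuli,
    M(x, y) M(x', y') = M(x, y') M(x', y) on A; take x' = y and y' = x. *)

Set Implicit Arguments.
Unset Strict Implicit.
Unset Printing Implicit Defensive.

Import Order.TTheory GRing.Theory Num.Theory.

Local Open Scope classical_set_scope.
Local Open Scope ring_scope.

(** * Products of real factors on one side of 1 *)

Lemma prod_eq1_ge1 (R : realType) (T : eqType) (l : seq T) (F : T -> R) :
  {in l, forall u, 1 <= F u} -> \prod_(u <- l) F u = 1 -> {in l, forall u, F u = 1}.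
Proof.
elim: l => [//|a l IH] h; rewrite big_cons => e.
have l1 : {in l, forall u, 1 <= F u} by move=> u ul; apply: h; rewrite inE ul orbT.
have a1 : 1 <= F a by apply: h; rewrite inE eqxx.
have p1 : 1 <= \prod_(u <- l) F u.
  rewrite big_seq; apply: (big_ind (fun x => 1 <= x)) => //.
  exact: mulr_ege1.
have [pe ae] : \prod_(u <- l) F u = 1 /\ F a = 1 by split; nra.
by move=> u; rewrite inE => /orP[/eqP->//|]; exact: IH.
Qed.

Lemma prod_eq1_le1 (R : realType) (T : eqType) (l : seq T) (F : T -> R) :
  {in l, forall u, 0 <= F u <= 1} -> \prod_(u <- l) F u = 1 ->
  {in l, forall u, F u = 1}.
Proof.
elim: l => [//|a l IH] h; rewrite big_cons => e.
have l1 : {in l, forall u, 0 <= F u <= 1} by move=> u ul; apply: h; rewrite inE ul orbT.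
have /andP[a0 a1] : 0 <= F a <= 1 by apply: h; rewrite inE eqxx.
have /andP[p0 p1] : 0 <= \prod_(u <- l) F u <= 1.
  rewrite big_seq; apply: (big_ind (fun x => 0 <= x <= 1)) => //.
    by rewrite ler01 lexx.
  by move=> x y /andP[x0 x1] /andP[y0 y1]; rewrite mulr_ge0// mulr_ile1.
have [pe ae] : \prod_(u <- l) F u = 1 /\ F a = 1 by split; nra.
by move=> u; rewrite inE => /orP[/eqP->//|]; exact: IH.
Qed.

(** * Ultrametric norms and points far from a finite set *)

Section Ultranorm.
Variables (R : realType) (K : ultraClosedFieldType R).
Implicit Types (x y z w t : K) (l q : seq K) (r s : R).

(** The axioms of the norm do not state this: it follows from [ball_cnorm], since 0 lies in every
    ball of positive radius about 0. *)
Lemma cnorm0 : cnorm (0 : K) = 0.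
Proof.
apply/eqP; rewrite eq_le cnorm_ge0 andbT; apply/ler_addgt0Pl => e e0.
have := @ballxx _ K 0 e e0.
by rewrite ball_cnorm /ball_ /= subr0 addr0 => /ltW.
Qed.

Lemma cnorm_eq0E x : (cnorm x == 0) = (x == 0).
Proof. by apply/eqP/eqP => [/cnorm_eq0|->]; rewrite ?cnorm0. Qed.

Lemma cnorm_gt0 x : (0 < cnorm x) = (x != 0).
Proof. by rewrite lt0r cnorm_ge0 andbT cnorm_eq0E. Qed.

Lemma cnorm1 : cnorm (1 : K) = 1.
Proof.
have n0 : cnorm (1 : K) != 0 by rewrite cnorm_eq0E oner_eq0.
by apply: (mulfI n0); rewrite -cnormM !mulr1.
Qed.

Lemma cnormX x n : cnorm (x ^+ n) = cnorm x ^+ n.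
Proof. by elim: n => [|n IH]; rewrite ?expr0 ?cnorm1// !exprS cnormM IH. Qed.

Lemma cnormN x : cnorm (- x) = cnorm x.
Proof.
have h : cnorm (- 1 : K) = 1.
  apply/eqP; rewrite -(@eqrXn2 _ 2)// ?cnorm_ge0//.
  by rewrite -cnormX sqrrN expr1n cnorm1 expr1n.
by rewrite -mulN1r cnormM h mul1r.
Qed.

Lemma cnormBC x y : cnorm (x - y) = cnorm (y - x).
Proof. by rewrite -cnormN opprB. Qed.

Lemma cnormV x : cnorm x^-1 = (cnorm x)^-1.
Proof.
have [->|x0] := eqVneq x 0; first by rewrite invr0 cnorm0 invr0.
have n0 : cnorm x != 0 by rewrite cnorm_eq0E.
by apply: (mulfI n0); rewrite -cnormM !divff// cnorm1.
Qed.

Lemma cnorm_prod (I : Type) (r : seq I) (F : I -> K) :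
  cnorm (\prod_(i <- r) F i) = \prod_(i <- r) cnorm (F i).
Proof. by apply: (big_morph (@cnorm R K)); [exact: cnormM|exact: cnorm1]. Qed.

Lemma cnormD_le x y r : cnorm x <= r -> cnorm y <= r -> cnorm (x + y) <= r.
Proof. by move=> h k; apply: le_trans (cnormD _ _) _; rewrite ge_max h. Qed.

Lemma cnormB_le x y r : cnorm x <= r -> cnorm y <= r -> cnorm (x - y) <= r.
Proof. by move=> h k; apply: cnormD_le; rewrite ?cnormN. Qed.

Lemma cnormD_lt x y r : cnorm x < r -> cnorm y < r -> cnorm (x + y) < r.
Proof. by move=> h k; apply: le_lt_trans (cnormD _ _) _; rewrite gt_max h. Qed.

Lemma cdist_le y x z r :
  cnorm (x - y) <= r -> cnorm (y - z) <= r -> cnorm (x - z) <= r.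
Proof. by move=> h k; rewrite -(subrKA y); exact: cnormD_le. Qed.

Lemma cdist_lt y x z r :
  cnorm (x - y) < r -> cnorm (y - z) < r -> cnorm (x - z) < r.
Proof. by move=> h k; rewrite -(subrKA y); exact: cnormD_lt. Qed.

(** The isosceles principle of ultrametric geometry. *)
Lemma cdist_iso y x z :
  cnorm (x - y) < cnorm (y - z) -> cnorm (x - z) = cnorm (y - z).
Proof.
move=> h; apply/eqP; rewrite eq_le (cdist_le (ltW h))//= leNgt; apply/negP => k.
by have := @cdist_lt x y z _ _ k; rewrite cnormBC h ltxx => /(_ isT).
Qed.

Lemma cnorm_iso x y : cnorm (x - y) < cnorm y -> cnorm x = cnorm y.
Proof. by move=> h; have := @cdist_iso y x 0; rewrite !subr0; exact. Qed.

Definition oball x r : set K := [set z | cnorm (z - x) < r].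
Definition cball x r : set K := [set z | cnorm (z - x) <= r].

Lemma oballxx x r : 0 < r -> oball x r x.
Proof. by rewrite /oball /= subrr cnorm0. Qed.

Lemma oball_sym x y r : oball x r y -> oball y r x.
Proof. by rewrite /oball /= cnormBC. Qed.

Lemma cauchy_seq_cvg (u : nat -> K) :
  (forall e : R, 0 < e -> exists N, forall m n, (N <= m)%N -> (N <= n)%N ->
     cnorm (u m - u n) < e) ->
  exists l : K, forall e : R, 0 < e ->
    exists N, forall n, (N <= n)%N -> cnorm (u n - l) < e.
Proof.
move=> h.
have : cauchy (u @ \oo).
  apply/cauchy_ballP => e e0; have [N hN] := h _ e0.
  exists ([set u n | n in [set n | (N <= n)%N]], [set u n | n in [set n | (N <= n)%N]]) => /=.
    by split; exists N => // n /= Nn; exists n.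
  by move=> [x y] [/= [m Nm <-] [n Nn <-]]; rewrite ball_cnorm; exact: hN.
move=> /cauchy_cvg/cvg_ballP hl; exists (lim (u @ \oo)) => e e0.
have [N _ hN] := hl _ e0; exists N => n Nn.
by have := hN n Nn; rewrite /= ball_cnorm /ball_ /= cnormBC.
Qed.

Lemma cnorm_hausdorff : hausdorff_space K.
Proof.
rewrite ball_hausdorff => a b ab.
have d0 : 0 < cnorm (a - b) by rewrite cnorm_gt0 subr_eq0.
exists (PosNum d0, PosNum d0) => /=; apply/eqP; rewrite -subset0 => z [].
rewrite ball_cnorm /ball_ /= => az; rewrite (cnormBC b z) => zb.
by have := cdist_lt az zb; rewrite ltxx.
Qed.

Lemma polyF P : {l : seq K & forall z, P.[z] = lead_coef P * \prod_(t <- l) (z - t)}.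
Proof.
have [l hl] := closed_field_poly_normal P; exists l => z.
rewrite {1}hl hornerZ horner_prod; congr (_ * _).
by apply: eq_bigr => t _; rewrite hornerXsubC.
Qed.

(* After rescaling, a root of [prod (X - t) = 1], the product being over the
   [t] of norm at most 1, is at distance 1 from all of them. *)
Lemma separated_point l x w : w != 0 ->
  exists z, cnorm (z - x) = cnorm w /\ {in l, forall t, cnorm w <= cnorm (z - t)}.
Proof.
move=> w0; have nw0 : 0 < cnorm w by rewrite cnorm_gt0.
(* Adjoining [x] puts 0 into [L], so that [P] is non-constant and its root has norm exactly 1.
   Points of [l] farther than [cnorm w] from [x] are dropped here and treated at the end. *)
pose l' := x :: [seq t <- l | cnorm (t - x) <= cnorm w].
pose L := [seq (t - x) / w | t <- l'].
have L1 t : t \in L -> cnorm t <= 1.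
  move=> /mapP[u ul ->]; rewrite cnormM cnormV ler_pdivrMr// mul1r.
  move: ul; rewrite inE => /orP[/eqP->|]; first by rewrite subrr cnorm0 ltW.
  by rewrite mem_filter => /andP[].
pose P : {poly K} := \prod_(t <- L) ('X - t%:P) - 1%:P.
have sP : size P != 1%N.
  have sz : size (\prod_(t <- L) ('X - t%:P)) = (size L).+1 by rewrite size_prod_XsubC.
  rewrite size_polyDl sz// size_opp size_polyC oner_eq0 /= ltnS.
  by rewrite size_map.
have /closed_rootP[t] := sP.
rewrite /root /P hornerD hornerN hornerC horner_prod subr_eq0 => /eqP ht.
have ht' : \prod_(u <- L) cnorm (t - u) = 1.
  rewrite -cnorm_prod -cnorm1; congr cnorm; rewrite -[RHS]ht.
  by apply: eq_bigr => u _; rewrite hornerXsubC.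
(* Otherwise every factor [cnorm (t - u)] would equal [cnorm t > 1], and so would not allow the
   product 1. *)
have t1 : cnorm t <= 1.
  rewrite leNgt; apply/negP => t1.
  have tL u : u \in L -> cnorm (t - u) = cnorm t.
    move=> /L1 u1; rewrite -[LHS]cnormN opprB.
    have := @cdist_iso 0 u t; rewrite subr0 sub0r cnormN; apply.
    exact: le_lt_trans t1.
  have := prod_eq1_ge1 (_ : {in L, forall u, 1 <= cnorm (t - u)}) ht'.
  have L0 : 0 \in L by rewrite inE subrr mul0r eqxx.
  move=> /(_ _ 0 L0); rewrite subr0 => h; have := t1; rewrite h ?ltxx// => u /tL ->.
  exact: ltW.
have htL : {in L, forall u, cnorm (t - u) = 1}.
  apply: prod_eq1_le1 ht' => u uL; rewrite cnorm_ge0/=.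
  by apply: cnormB_le => //; exact: L1.
exists (x + w * t); split.
  have /htL : 0 \in L by rewrite inE subrr mul0r eqxx.
  by rewrite subr0 addrAC subrr add0r cnormM => ->; rewrite mulr1.
move=> u ul; have [uw|uw] := leP (cnorm (u - x)) (cnorm w).
  have /htL h : (u - x) / w \in L by apply/mapP; exists u => //; rewrite inE mem_filter uw ul orbT.
  have -> : x + w * t - u = w * (t - (u - x) / w) by field.
  by rewrite cnormM h mulr1.
rewrite cnormBC; have -> : u - (x + w * t) = - (w * t - (u - x)) by ring.
rewrite cnormN; have := @cdist_iso 0 (w * t) (u - x); rewrite subr0 sub0r cnormN => ->.
  exact: ltW.
rewrite cnormM; apply: le_lt_trans uw; rewrite -[leRHS]mulr1.
by rewrite ler_wpM2l// ltW.
Qed.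

End Ultranorm.

(** * Powers of real numbers near, above and below 1 *)

Section RealPowers.
Variable R : realType.
Implicit Types (x y a b : R).

Lemma exprn_gt1_unbounded y b : 1 < y -> exists n, b < y ^+ n.
Proof.
move=> y1; have bern n : 1 + n%:R * (y - 1) <= y ^+ n.
  elim: n => [|n IH]; first by rewrite mul0r addr0 expr0.
  have h : y * (1 + n%:R * (y - 1)) <= y * y ^+ n by rewrite ler_wpM2l//; lra.
  rewrite exprS -natr1; have : 0 <= n%:R * (y - 1) ^+ 2 by rewrite mulr_ge0// sqr_ge0.
  nra.
exists (Num.trunc (b / (y - 1))).+1; apply: lt_le_trans (bern _).
have d0 : 0 < y - 1 by lra.
have := truncnS_gt (b / (y - 1)).
by rewrite ltr_pdivrMr//; lra.
Qed.

Lemma exprn_lt1_small y b : 0 <= y < 1 -> 0 < b -> exists n, y ^+ n < b.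
Proof.
move=> /andP[]; rewrite le_eqVlt => /orP[/eqP<- _ b0|y0 y1 b0].
  by exists 1%N; rewrite expr1.
have [|n] := @exprn_gt1_unbounded y^-1 b^-1; first by rewrite invf_gt1.
by rewrite exprVn ltf_pV2 ?posrE ?exprn_gt0// => h; exists n.
Qed.

Lemma exprn_near1 (q : R) n : 1 < q -> exists2 y, 1 < y & y ^+ n < q.
Proof.
elim: n q => [|n IH] q q1; first by exists 2; rewrite ?expr0//; lra.
have q0 : 0 <= q by lra.
have s1 : 1 < Num.sqrt q by rewrite -[ltLHS]sqrtr1 ltr_sqrt//; lra.
have [y y1 yn] := IH _ s1.
exists (Num.min y (Num.sqrt q)); first by rewrite lt_min y1.
set m := Num.min _ _; have m0 : 0 <= m by rewrite le_min; lra.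
have my : m <= y by rewrite ge_min lexx.
have mq : m <= Num.sqrt q by rewrite ge_min lexx orbT.
rewrite exprS -(sqr_sqrtr q0) expr2.
apply: (@le_lt_trans _ _ (Num.sqrt q * m ^+ n)); first by rewrite ler_wpM2r// exprn_ge0.
rewrite ltr_pM2l; last by lra.
by apply: le_lt_trans yn; rewrite lerXn2r// nnegrE; lra.
Qed.

End RealPowers.

(** * Density of the value group *)

Section ValueGroup.
Variables (R : realType) (K : ultraClosedFieldType R).
Hypothesis nontriv : exists w : K, 0 < cnorm w < 1.

(** Since [K] is algebraically closed, an element of norm strictly between 0 and 1 has [n]-th roots
    [t]; for large [n] the norm of [t] lies between [a / b] and 1, so the norms of the powers of [t]
    cannot jump over the interval from [a] to [b]. *)
Lemma cnorm_dense (a b : R) : 0 < a -> a < b -> exists w : K, a < cnorm w < b.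
Proof.
move=> a0 ab; have b0 : 0 < b by apply: lt_trans ab.
have [w /andP[w0 w1]] := nontriv.
have ab1 : 0 <= a / b < 1 by rewrite divr_ge0 ?ltW//= ltr_pdivrMr// mul1r.
have [n hn] := exprn_lt1_small ab1 w0.
have n0 : n != 0%N by apply: contraTneq hn => ->; rewrite expr0 -leNgt ltW.
have [t /eqP tn] : exists t : K, t ^+ n == w.
  have sz : size ('X^n - w%:P) != 1%N.
    by rewrite size_XnsubC ?lt0n// eqSS.
  have /closed_rootP[t] := sz.
  by rewrite /root !hornerE subr_eq0; exists t.
have tn' : cnorm t ^+ n = cnorm w by rewrite -tn cnormX.
have t0 : 0 < cnorm t.
  rewrite lt_neqAle cnorm_ge0 andbT eq_sym; apply: contraTneq w0 => e.
  by rewrite -tn' e expr0n (negbTE n0) ltxx.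
have t1 : cnorm t < 1.
  rewrite ltNge; apply: contraTN w1 => /(exprn_ege1 n); rewrite tn'.
  by rewrite -leNgt.
have tab : a / b < cnorm t.
  rewrite ltNge; apply: contraTN hn => h; rewrite -leNgt -tn' lerXn2r// nnegrE ltW//.
  exact: lt_le_trans t0 h.
(* The powers of [t] start above [b], at exponent [-N]. The first one below [b] exceeds [a], because
   its predecessor is at least [b]. *)
have [|N hN] := @exprn_gt1_unbounded _ (cnorm t)^-1 b; first by rewrite invf_gt1.
have ex : exists j, (cnorm t)^-1 ^+ N * cnorm t ^+ j < b.
  have u0 : 0 < (cnorm t)^-1 ^+ N by apply: lt_trans hN.
  have [|j hj] := @exprn_lt1_small _ (cnorm t) (b / (cnorm t)^-1 ^+ N) _ (divr_gt0 b0 u0).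
    by rewrite ltW.
  by exists j; rewrite mulrC -ltr_pdivlMr.
have [[|j] hj jmin] := ex_minnP ex.
  by move: hj; rewrite expr0 mulr1 ltNge ltW.
exists (t^-1 ^+ N * t ^+ j.+1); rewrite cnormM !cnormX cnormV hj andbT.
have : b <= (cnorm t)^-1 ^+ N * cnorm t ^+ j.
  by rewrite leNgt; apply/negP => /jmin; rewrite ltnn.
rewrite -(ler_pM2r t0) -mulrA -exprSr; apply: lt_le_trans.
by rewrite mulrC -ltr_pdivrMr.
Qed.

End ValueGroup.

(** * Gauss norms of rational functions and the maximum principle *)

Section GaussNorm.
Variables (R : realType) (K : ultraClosedFieldType R).
Implicit Types (A : set K) (x y z w t : K) (l q : seq K) (r s c : R) (g : K -> K).

Definition nprod l z : R := \prod_(t <- l) cnorm (z - t).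
(** The Gauss norm, on the disc of centre [x] and radius [r], of the monic polynomial with roots
    [l]: it is multiplicative, and [X - t] has Gauss norm [max r (cnorm (x - t))]. *)
Definition gprod l x r : R := \prod_(t <- l) Num.max r (cnorm (x - t)).

Lemma nprod_ge0 l z : 0 <= nprod l z.
Proof. by apply: prodr_ge0 => t _; exact: cnorm_ge0. Qed.

Lemma nprod_eq0 l z : (nprod l z == 0) = (z \in l).
Proof.
rewrite /nprod; elim: l => [|t l IH]; first by rewrite big_nil oner_eq0.
by rewrite big_cons mulf_eq0 IH cnorm_eq0E subr_eq0 inE.
Qed.

Lemma gprod_gt0 l x r : 0 < r -> 0 < gprod l x r.
Proof. by move=> r0; apply: prodr_gt0 => t _; rewrite lt_max r0. Qed.

Lemma nprod_le_gprod l x z r : cnorm (z - x) <= r -> nprod l z <= gprod l x r.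
Proof.
move=> zx; apply: ler_prod => t _; rewrite cnorm_ge0/=.
by apply: (@cdist_le _ _ x); rewrite le_max ?zx ?lexx ?orbT.
Qed.

Lemma nprod_gprod l x z r : cnorm (z - x) <= r ->
  {in l, forall t, r <= cnorm (z - t)} -> nprod l z = gprod l x r.
Proof.
move=> zx h; rewrite /nprod /gprod big_seq [RHS]big_seq; apply: eq_bigr => t /h tz.
apply/eqP; rewrite eq_le; apply/andP; split.
  by apply: (@cdist_le _ _ x); rewrite le_max ?zx ?lexx ?orbT.
by rewrite ge_max tz/=; apply: (@cdist_le _ _ z) => //; rewrite cnormBC (le_trans zx).
Qed.

Lemma nprod_far l x z r : cnorm (z - x) <= r ->
  {in l, forall t, r < cnorm (x - t)} -> nprod l z = gprod l x r.
Proof.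
move=> zx h; apply: nprod_gprod => // t /h xt.
by rewrite (@cdist_iso _ _ x) ?ltW//; apply: le_lt_trans xt.
Qed.

(** In logarithmic coordinates each factor is convex in the radius, with slope 0 or 1. The count is
    the right-hand slope at [r], and a convex function lies above its tangent on both sides. *)
Lemma gprod_tangent l x r s : 0 < r -> 0 < s ->
  gprod l x r * (s / r) ^+ count (fun t => cnorm (x - t) <= r) l <= gprod l x s.
Proof.
move=> r0 s0; rewrite /gprod; elim: l => [|t l IH]; first by rewrite !big_nil mulr1.
rewrite !big_cons /= exprD mulrACA; apply: ler_pM => //.
- by rewrite mulr_ge0 ?exprn_ge0 ?divr_ge0 ?le_max ?(ltW r0) ?(ltW s0).
- by rewrite ltW// mulr_gt0 ?exprn_gt0 ?divr_gt0 ?gprod_gt0.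
have [h|h] := leP (cnorm (x - t)) r.
  by rewrite expr1 mulrCA divff ?gt_eqF// mulr1 le_max lexx.
by rewrite expr0 mulr1 le_max lexx orbT.
Qed.

(** No root is at a distance strictly between [r] and [r'] from [x], so the slope does not change
    between these radii. *)
Lemma gprod_affine l x r s (r' : R) : 0 < r -> r <= s <= r' ->
  {in l, forall t, (cnorm (x - t) <= r) || (r' <= cnorm (x - t))} ->
  gprod l x s = gprod l x r * (s / r) ^+ count (fun t => cnorm (x - t) <= r) l.
Proof.
move=> r0 /andP[rs sr']; rewrite /gprod; elim: l => [|t l IH] h; first by rewrite !big_nil mulr1.
rewrite !big_cons /= exprD mulrACA IH; last by move=> u ul; apply: h; rewrite inE ul orbT.
congr (_ * _); have := h t; rewrite inE eqxx => /(_ isT).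
have [k _|k /= k'] := leP (cnorm (x - t)) r.
  by rewrite expr1 mulrCA divff ?gt_eqF// mulr1; apply/max_idPl/(le_trans k).
by rewrite expr0 mulr1; apply/max_idPr/(le_trans sr').
Qed.

(** Only the modulus of a rational function is retained: [l] lists its zeros, [q] its poles, with
    multiplicity and possibly with common entries. The value [c = 0] accommodates the zero
    function. *)
Definition modulus_on A g c l q :=
  [/\ 0 <= c, {in q, forall t, ~ A t} &
      forall z, A z -> cnorm (g z) = c * nprod l z / nprod q z].

Definition gauss c l q x r : R := c * gprod l x r / gprod q x r.

Lemma rational_modulus A g : rational_on A g ->
  exists c l q, modulus_on A g c l q.
Proof.
move=> [P [Q PQ]]; have [l hl] := polyF P; have [q hq] := polyF Q.
exists (cnorm (lead_coef P) / cnorm (lead_coef Q)), l, q; split.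
- by rewrite divr_ge0 ?cnorm_ge0.
- move=> t tq /PQ[+ _]; rewrite hq (perm_big _ (perm_to_rem tq)) big_cons subrr /= mul0r.
  by rewrite mulr0 eqxx.
move=> z /PQ[Q0 ->]; rewrite hl hq !cnormM cnormV cnormM !cnorm_prod invfM.
by rewrite mulrACA !mulrA.
Qed.

Section Modulus.
Variables (A : set K) (g : K -> K) (c : R) (l q : seq K).
Hypothesis gM : modulus_on A g c l q.

Lemma modulus_root t : A t -> t \in l -> g t = 0.
Proof.
have [_ _ h] := gM => At; rewrite -nprod_eq0 => /eqP l0.
by apply/cnorm_eq0; rewrite h// l0 mulr0 mul0r.
Qed.

Lemma modulus_zero t : A t -> g t = 0 -> c = 0 \/ t \in l.
Proof.
have [_ h k] := gM => At gt; have /eqP := k t At.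
rewrite gt cnorm0 eq_sym !mulf_eq0 invr_eq0 !nprod_eq0 => /orP[/orP[/eqP|]|/h//]; by [left|right].
Qed.

Lemma pole_far z r t : oball z r `<=` A -> t \in q -> r <= cnorm (z - t).
Proof.
have [_ h _] := gM => zA /h; rewrite cnormBC => tA; rewrite leNgt; apply/negP => tr.
exact/tA/zA.
Qed.

Lemma pole_far_closed z r t : cball z r `<=` A -> t \in q -> r < cnorm (z - t).
Proof.
have [_ h _] := gM => zA /h; rewrite cnormBC => tA; rewrite ltNge; apply/negP => tr.
exact/tA/zA.
Qed.

(** With neither zeros nor poles in the open disc of radius [r] about [z], each of them is at
    distance at least [r] from [z], and then this distance is its factor in the Gauss norm centred
    at [x]. *)
Lemma gauss_regular x z r : 0 < r -> oball z r `<=` A -> cnorm (z - x) <= r ->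
  (forall u, oball z r u -> g u != 0) -> cnorm (g z) = gauss c l q x r.
Proof.
have [_ _ h] := gM => r0 zA zx g0; rewrite h; last exact/zA/oballxx.
rewrite (@nprod_gprod l x _ r)// ?(@nprod_gprod q x _ r)//.
  by move=> t; exact: pole_far.
move=> t tl; rewrite leNgt; apply/negP; rewrite cnormBC => tz.
by have /eqP := g0 t tz; apply; apply: modulus_root => //; exact: zA.
Qed.

Lemma modulus_le_gauss x z r : 0 < r -> cball x r `<=` A -> cnorm (z - x) <= r ->
  cnorm (g z) <= gauss c l q x r.
Proof.
have [c0 _ h] := gM => r0 xA zx; rewrite h; last exact: xA.
rewrite (@nprod_far q x _ r)//; last by move=> t; exact: pole_far_closed.
rewrite /gauss; apply: ler_wpM2r; first by rewrite invr_ge0 ltW ?gprod_gt0.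
apply: ler_wpM2l => //.
exact: nprod_le_gprod.
Qed.

Lemma gauss_attained x w : w != 0 -> cball x (cnorm w) `<=` A ->
  exists z, cnorm (z - x) = cnorm w /\ cnorm (g z) = gauss c l q x (cnorm w).
Proof.
have [c0 _ h] := gM => w0 xA; have [z [zx zl]] := separated_point l x w0.
exists z; split=> //; rewrite h; last by apply: xA; rewrite /cball /= zx.
rewrite (@nprod_gprod l x _ (cnorm w)) ?zx// (@nprod_far q x _ (cnorm w)) ?zx//.
by move=> t; exact: pole_far_closed.
Qed.

End Modulus.

(** The Gauss norm bounds [g] on the disc and is attained on the boundary circle. *)
Lemma maximum_principle A g x w (e : R) : rational_on A g -> w != 0 ->
  cball x (cnorm w) `<=` A ->
  (forall z, cnorm (z - x) = cnorm w -> cnorm (g z) <= e) ->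
  forall z, cnorm (z - x) <= cnorm w -> cnorm (g z) <= e.
Proof.
move=> /rational_modulus[c [l [q gM]]] w0 xA h z zx.
have [u [/h ue ug]] := gauss_attained gM w0 xA.
by apply: le_trans ue; rewrite ug; apply: (modulus_le_gauss gM) => //; rewrite cnorm_gt0.
Qed.

Lemma rational_bounded A g x r : rational_on A g -> 0 < r -> cball x r `<=` A ->
  exists C, forall z, cnorm (z - x) <= r -> cnorm (g z) <= C.
Proof.
move=> /rational_modulus[c [l [q gM]]] r0 xA; exists (gauss c l q x r) => z zx.
exact: (modulus_le_gauss gM).
Qed.

End GaussNorm.

(** * Uniform limits of rational functions and their zeros *)

Section Approx.
Variables (R : realType) (K : ultraClosedFieldType R).
Implicit Types (A D : set K) (x y z w t : K) (l q : seq K) (r s c e d : R).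
Implicit Types (f g h : K -> K).

(** Roots outside the closed disc contribute their full Gauss factor; each of the at most [k] roots
    inside costs at most a factor [d / r]. *)
Lemma nprod_ge l x z r d (k : nat) : 0 < d <= r -> cnorm (z - x) <= r ->
  {in l, forall t, cnorm (x - t) <= r -> d <= cnorm (z - t)} ->
  (count (fun t => (cnorm (x - t) <= r)%R) l <= k)%N ->
  gprod l x r * (d / r) ^+ k <= nprod l z.
Proof.
move=> /andP[d0 dr] zx; have r0 : 0 < r by apply: lt_le_trans dr.
have dr0 : 0 <= d / r by rewrite divr_ge0 ?ltW.
have dr1 : d / r <= 1 by rewrite ler_pdivrMr// mul1r.
elim: l k => [|t l IH] k h.
  by rewrite /gprod /nprod !big_nil mul1r => _; rewrite exprn_ile1.
rewrite /gprod /nprod !big_cons /=.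
have {}IH := IH _ (fun u (ul : u \in l) => h u (mem_behead (s := t :: l) ul)).
have := h t (mem_head _ _).
have [xt /(_ isT) dt|xt _] := leP (cnorm (x - t)) r.
  case: k => [//|k]; rewrite add1n ltnS => /IH{}IH.
  rewrite exprS mulrACA; apply: ler_pM => //.
  - by rewrite mulr_ge0// ltW.
  - by rewrite mulr_ge0 ?exprn_ge0// ltW// gprod_gt0.
  - by rewrite mulrC divfK ?gt_eqF.
rewrite add0n => /IH{}IH; rewrite -mulrA; apply: ler_pM => //.
- by rewrite cnorm_ge0.
- by rewrite mulr_ge0 ?exprn_ge0// ltW// gprod_gt0.
- by rewrite (@cdist_iso _ _ x)//; apply: le_lt_trans xt.
Qed.

(** A form of the Schwarz lemma: the factor of the root [t] is [cnorm (z - t)] instead of its Gauss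
    norm [r]. *)
Lemma nprod_schwarz l x z t r : 0 < r -> cnorm (z - x) <= r -> cnorm (x - t) <= r ->
  t \in l -> nprod l z <= gprod l x r * (cnorm (z - t) / r).
Proof.
move=> r0 zx xt tl; rewrite /nprod /gprod !(perm_big _ (perm_to_rem tl)) !big_cons /=.
rewrite (max_idPl xt) mulrAC mulrCA divff ?gt_eqF// mulr1 ler_wpM2l ?cnorm_ge0//.
exact: nprod_le_gprod.
Qed.

(** Stated for an arbitrary set, since it is also applied to open discs. *)
Definition approx A h :=
  forall e, 0 < e -> exists2 g, rational_on A g & forall z, A z -> cnorm (h z - g z) <= e.

Lemma rational_sub A D g : D `<=` A -> rational_on A g -> rational_on D g.
Proof. by move=> DA [P [Q h]]; exists P, Q => z /DA; exact: h. Qed.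

Lemma approx_sub A D h : D `<=` A -> approx A h -> approx D h.
Proof.
move=> DA hh e /hh[g gA gh]; exists g; first exact: rational_sub gA.
by move=> z /DA; exact: gh.
Qed.

Lemma oball_recenter x y r : oball x r y -> oball y r = oball x r.
Proof.
move=> xy; apply/seteqP; split=> z zy; first exact: (cdist_lt zy xy).
by apply: (cdist_lt zy); exact: oball_sym xy.
Qed.

Lemma near_cnorm x y e : cnorm (x - y) <= e -> e < cnorm x -> cnorm y = cnorm x.
Proof. by move=> xy ex; apply/cnorm_iso/(le_lt_trans _ ex); rewrite cnormBC. Qed.

(* [Z e] stands for the zeros of the approximants of precision [e]. *)
Lemma tracking_limit (Z : R -> K -> Prop) (s e0 : R) : 0 < s -> 0 < e0 ->
  (forall e, 0 < e <= e0 -> exists z, Z e z) ->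
  (forall d, 0 < d <= s -> exists2 e1, 0 < e1 &
     forall e e' z, 0 < e' <= e -> e <= e1 -> Z e z -> exists2 z', Z e' z' & cnorm (z' - z) < d) ->
  exists u, forall d e, 0 < d -> 0 < e -> exists z e', [/\ 0 < e' <= e, Z e' z & cnorm (u - z) < d].
Proof.
move=> s0 e00 Z1 Z2.
have /choice[E hE] : forall d, exists e1, 0 < d <= s -> 0 < e1 /\
  forall e e' z, 0 < e' <= e -> e <= e1 -> Z e z -> exists2 z', Z e' z' & cnorm (z' - z) < d.
  move=> d; have [ds|] := boolP (0 < d <= s); last by exists 0.
  by have [e1 ? ?] := Z2 d ds; exists e1.
pose dl n := s / 2 ^+ n.
have dl_gt0 n : 0 < dl n by rewrite divr_gt0 ?exprn_gt0.
have dlS n : dl n.+1 <= dl n.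
  by rewrite ler_pM2l// lef_pV2 ?posrE ?exprn_gt0// exprS ler_peMl ?exprn_ge0//; lra.
have dl_le m n : (m <= n)%N -> dl n <= dl m.
  by move=> /subnK <-; elim: (n - m)%N => // k IH; rewrite addSn (le_trans (dlS _)).
have dls n : 0 < dl n <= s by rewrite dl_gt0 (le_trans (dl_le 0%N n _))// /dl expr0 divr1.
(* The precision [ep n] is at most [E (dl n)], so a zero at stage [n] has one at stage [n.+1] within
   [dl n]. As [dl n] tends to 0, the ultrametric inequality makes the chosen zeros a Cauchy
   sequence. *)
pose fix ep n := if n is m.+1 then Num.min (ep m / 2) (E (dl m.+1))
                 else Num.min e0 (E (dl 0%N)).
have ep0 n : 0 < ep n.
  elim: n => [|n IH] /=; rewrite lt_min ?e00 ?divr_gt0//=; exact: (hE _ (dls _)).1.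
have epS n : ep n.+1 <= ep n by rewrite /= ge_min ler_pdivrMr//; have := ep0 n; nra.
have epE n : ep n <= E (dl n) by case: n => [|n] /=; rewrite ge_min lexx orbT.
have ep_small e : 0 < e -> exists N, forall n, (N <= n)%N -> ep n <= e.
  move=> ee; have h : 0 <= (2^-1 : R) < 1 by lra.
  have [N hN] := exprn_lt1_small h (divr_gt0 ee e00); exists N.
  have N2 n : ep n <= e0 * 2^-1 ^+ n.
    elim: n => [|n IH]; first by rewrite expr0 mulr1 /= ge_min lexx.
    by rewrite /= ge_min exprSr mulrA ler_pM2r ?invr_gt0// IH.
  move=> n Nn; apply: (le_trans (N2 n)); rewrite mulrC -ler_pdivlMr//.
  apply: (le_trans _ (ltW hN)); rewrite -(subnK Nn) exprD ler_piMl ?exprn_ge0//.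
  by rewrite exprn_ile1//; lra.
have [z0 Zz0] : exists z, Z (ep 0%N) z by apply: Z1; rewrite ep0 /= ge_min lexx.
have /choice[F hF] : forall p : nat * K, exists z', Z (ep p.1) p.2 ->
    Z (ep p.1.+1) z' /\ cnorm (z' - p.2) < dl p.1.
  move=> [n z] /=; have [Zz|] := pselect (Z (ep n) z); last by exists z.
  have [|z' Zz' zz'] := (hE _ (dls n)).2 (ep n) (ep n.+1) z _ (epE n) Zz.
    by rewrite ep0 epS.
  by exists z'.
pose fix u n := if n is m.+1 then F (m, u m) else z0.
have Zu n : Z (ep n) (u n) by elim: n => [//|n IH] /=; exact: (hF (n, u n) IH).1.
have uS n : cnorm (u n.+1 - u n) < dl n by exact: (hF (n, u n) (Zu n)).2.
have uN N n : (N <= n)%N -> cnorm (u n - u N) < dl N.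
  move=> /subnK <-; elim: (n - N)%N => [|k IH]; first by rewrite add0n subrr cnorm0.
  by apply: cdist_lt IH; apply: lt_le_trans (uS _) _; rewrite dl_le ?leq_addl.
have dl_small d : 0 < d -> exists N, dl N < d.
  move=> d0; have h : 0 <= (2^-1 : R) < 1 by lra.
  have [N hN] := exprn_lt1_small h (divr_gt0 d0 s0); exists N.
  by rewrite /dl mulrC -ltr_pdivlMr// -exprVn.
have [|v hv] := @cauchy_seq_cvg _ _ u.
  move=> d /dl_small[N hN]; exists N => m n Nm Nn; apply: (lt_trans _ hN).
  by apply: (cdist_lt (uN _ _ Nm)); rewrite cnormBC; exact: uN.
exists v => d e d0 ee; have [N1 h1] := hv _ d0; have [N2 h2] := ep_small _ ee.
exists (u (maxn N1 N2)), (ep (maxn N1 N2)); split=> //.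
  by rewrite ep0 h2// leq_maxr.
by rewrite cnormBC h1// leq_maxl.
Qed.

Hypothesis nontriv : exists w : K, 0 < cnorm w < 1.

(** Fine approximants have the same moduli as [h] at [x] and [z2], hence a zero in the closed disc
    through [z2], where their number of zeros is uniformly bounded. Zeros of a finer approximant are
    therefore close to those of a coarser one; [tracking_limit] gives a limit, and the Schwarz bound
    shows that [h] vanishes there. *)
Lemma zero_in_disc x r h z2 : approx (oball x r) h -> oball x r z2 ->
  cnorm (h x) < cnorm (h z2) -> exists2 z, oball x r z & h z = 0.
Proof.
move=> hD z2D hlt; have [hx0|hx0] := eqVneq (h x) 0.
  by exists x => //; apply: oballxx; apply: le_lt_trans z2D; exact: cnorm_ge0.
pose s := cnorm (z2 - x); pose b := cnorm (h z2).
have s0 : 0 < s.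
  by rewrite cnorm_gt0 subr_eq0; apply: contraTneq hlt => ->; rewrite ltxx.
have hx : 0 < cnorm (h x) by rewrite cnorm_gt0.
have b0 : 0 < b by apply: lt_trans hlt.
have [w /andP[sw wr]] := cnorm_dense nontriv s0 z2D.
pose s2 := cnorm w; have s20 : 0 < s2 by apply: lt_trans sw.
have w0 : w != 0 by rewrite -cnorm_gt0.
have s2D : cball x s2 `<=` oball x r by move=> z zx; apply: le_lt_trans wr.
have sD : cball x s `<=` oball x r by move=> z zx; apply/s2D/(le_trans zx)/ltW.
have xs : cball x s x by rewrite /cball /= subrr cnorm0 ltW.
pose e0 := cnorm (h x) / 2.
have e00 : 0 < e0 by rewrite divr_gt0.
have e0x : e0 < cnorm (h x) by rewrite /e0; lra.
have e0b : e0 < b by apply: lt_trans hlt.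
have [g0 g0D hg0] := hD _ e00.
have [C hC] := rational_bounded g0D s20 s2D.
pose M := Num.max e0 C.
have M0 : 0 < M by rewrite lt_max e00.
(* More than [k0] zeros in the disc of radius [s] would push the Gauss norm from at least [b] at [s]
   to above [M] at [s2], by log-convexity. *)
have [k0 hk0] : exists k, M / b < (s2 / s) ^+ k.
  by apply: exprn_gt1_unbounded; rewrite ltr_pdivlMr// mul1r.
have bounds g c l q : modulus_on (oball x r) g c l q -> rational_on (oball x r) g ->
    (forall z, oball x r z -> cnorm (h z - g z) <= e0) ->
    [/\ cnorm (g x) = cnorm (h x), cnorm (g z2) = b, gauss c l q x s2 <= M, b <= gauss c l q x s &
        (count (fun t => (cnorm (x - t) <= s)%R) l <= k0)%N].
  move=> gM gD hg.
  have gx : cnorm (g x) = cnorm (h x).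
    by apply: near_cnorm e0x; apply/hg/sD.
  have gz2 : cnorm (g z2) = b by apply: near_cnorm e0b; apply/hg.
  (* The fixed approximant [g0] bounds all finer ones on the larger disc, so that [M] and [k0] serve
     for all of them. *)
  have Ms : gauss c l q x s2 <= M.
    have [z [zs <-]] := gauss_attained gM w0 s2D.
    have zD : oball x r z by apply: s2D; rewrite /cball /= zs.
    rewrite -[g z]subr0; apply: (@cdist_le _ _ (h z)).
      by rewrite cnormBC le_max hg.
    apply: (@cdist_le _ _ (g0 z)); first by rewrite le_max hg0.
    by rewrite subr0 le_max hC ?orbT// zs.
  have bs : b <= gauss c l q x s by rewrite -gz2; apply: (modulus_le_gauss gM).
  split=> //; rewrite leqNgt; apply/negP => k0k.
  have : gauss c l q x s * (s2 / s) ^+ k0 <= gauss c l q x s2.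
    have [c0 _ _] := gM; rewrite /gauss.
    have qfar t : t \in q -> s2 < cnorm (x - t) by exact: (pole_far_closed gM).
    have qfar' t : t \in q -> s < cnorm (x - t) by move=> /qfar; apply: lt_trans.
    rewrite -(nprod_far xs qfar') -(nprod_far (z := x) _ qfar); last by rewrite subrr cnorm0 ltW.
    rewrite mulrAC ler_wpM2r ?invr_ge0 ?nprod_ge0// -mulrA ler_wpM2l//.
    apply: le_trans (gprod_tangent l x s0 s20); rewrite ler_wpM2l ?(ltW (gprod_gt0 _ _ _))//.
    by apply: ler_weXn2l; [rewrite ler_pdivlMr// mul1r ltW|exact: ltnW].
  apply/negP; rewrite -ltNge; apply: (le_lt_trans Ms).
  by move: hk0; rewrite ltr_pdivrMr// mulrC => /lt_le_trans; apply; rewrite ler_pM2r ?exprn_gt0 ?divr_gt0.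
pose Z e z := cball x s z /\ exists2 g, rational_on (oball x r) g &
  g z = 0 /\ forall z, oball x r z -> cnorm (h z - g z) <= e.
have Z1 e : 0 < e <= e0 -> exists z, Z e z.
  move=> /andP[ee ee0]; have [g gD hg] := hD _ ee.
  have [c [l [q gM]]] := rational_modulus gD.
  have [|gx gz2 _ _ _] := bounds _ _ _ _ gM gD.
    by move=> z /hg /le_trans; apply.
  have [t tl ts] : exists2 t, t \in l & cball x s t.
    apply: contrapT => no; move: hlt; rewrite -/b -gz2 -gx.
    have [_ _ gE] := gM; rewrite !gE//; last exact: sD.
    have far : {in l, forall t, s < cnorm (x - t)}.
      by move=> t tl; rewrite ltNge cnormBC; apply/negP => ts; apply: no; exists t.
    have qfar t : t \in q -> s < cnorm (x - t) by exact: (pole_far_closed gM).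
    rewrite (nprod_far xs far) (nprod_far (lexx s : cnorm (z2 - x) <= s) far).
    by rewrite (nprod_far xs qfar) (nprod_far (lexx s : cnorm (z2 - x) <= s) qfar) ltxx.
  exists t; split=> //; exists g => //; split=> //.
  exact: (modulus_root gM (sD _ ts) tl).
(* At a zero of the coarse approximant the fine one has modulus at most [e]. If its zeros all stayed
   at distance [d], [nprod_ge] would make this modulus at least [b * (d / s) ^+ k0]. *)
have Z2 d : 0 < d <= s -> exists2 e1, 0 < e1 &
     forall e e' z, 0 < e' <= e -> e <= e1 -> Z e z -> exists2 z', Z e' z' & cnorm (z' - z) < d.
  move=> /andP[d0 ds].
  have bd0 : 0 < b * (d / s) ^+ k0 by rewrite mulr_gt0// exprn_gt0// divr_gt0.
  exists (Num.min e0 (b * (d / s) ^+ k0 / 2)); first by rewrite lt_min e00 divr_gt0.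
  move=> e e' z /andP[e'0 e'e]; rewrite le_min => /andP[ee0 eb] [zs [g gD [gz hg]]].
  have [g' g'D hg'] := hD _ e'0.
  have [c [l [q gM]]] := rational_modulus g'D.
  have [|gx gz2 _ bs kk0] := bounds _ _ _ _ gM g'D.
    by move=> u /hg' /le_trans; apply; exact: le_trans ee0.
  have zD := sD _ zs.
  have g'z : cnorm (g' z) <= e.
    rewrite -[g' z]subr0 -gz; apply: (@cdist_le _ _ (h z)); last exact: hg.
    by rewrite cnormBC (le_trans _ e'e)// hg'.
  have [t [tl tz ts]] : exists t, [/\ t \in l, cnorm (t - z) < d & cball x s t].
    apply: contrapT => no; have /negP := lt_geF bd0; apply.
    have [c0 _ gE] := gM.
    have qfar t : t \in q -> s < cnorm (x - t) by exact: (pole_far_closed gM).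
    have : gauss c l q x s * (d / s) ^+ k0 <= cnorm (g' z).
      rewrite gE// (nprod_far zs qfar) /gauss mulrAC.
      apply: ler_wpM2r; first by rewrite invr_ge0 ltW ?gprod_gt0.
      rewrite -mulrA ler_wpM2l//.
      apply: nprod_ge => //; first by rewrite d0.
      move=> t tl ts; rewrite leNgt; apply/negP => tz; apply: no.
      by exists t; split=> //; rewrite /cball /= cnormBC.
    have : b * (d / s) ^+ k0 <= gauss c l q x s * (d / s) ^+ k0.
      by rewrite ler_wpM2r// exprn_ge0// divr_ge0// ltW.
    by lra.
  exists t => //; split=> //; exists g' => //; split=> //.
  exact: (modulus_root gM (sD _ ts) tl).
have [u hu] := tracking_limit s0 e00 Z1 Z2.
have us : cball x s u.
  have [z [e [_ [zs _] uz]]] := hu _ _ s0 e00.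
  by apply: (cdist_le (ltW uz)).
exists u; first exact: sD.
apply: contrapT => /eqP; rewrite -cnorm_gt0 => hu0.
have e1 : 0 < Num.min e0 (cnorm (h u) / 2) by rewrite lt_min e00 divr_gt0.
(* At a smaller distance from a zero, the Schwarz bound [M * (cnorm (u - z) / s2)] falls below
   [cnorm (h u)]. *)
have d1 : 0 < cnorm (h u) * s2 / M by rewrite divr_gt0// mulr_gt0.
have [z [e [/andP[ee]]]] := hu _ _ d1 e1.
rewrite le_min => /andP[ee0 eu] [zs [g gD [gz hg]]] uz.
have [c [l [q gM]]] := rational_modulus gD.
have [|_ _ Ms _ _] := bounds _ _ _ _ gM gD.
  by move=> v /hg /le_trans; apply.
have gu : cnorm (g u) = cnorm (h u).
  apply: (near_cnorm (hg _ (sD _ us))); apply: le_lt_trans eu _; lra.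
have [c0 _ gE] := gM.
have us2 : cball x s2 u by apply/(le_trans us)/ltW.
have : cnorm (g u) <= gauss c l q x s2 * (cnorm (u - z) / s2).
  have [c00|zl] := modulus_zero gM (sD _ zs) gz; first by rewrite gE ?c00 /gauss ?mul0r//; exact: sD.
  have qfar t : t \in q -> s2 < cnorm (x - t) by exact: (pole_far_closed gM).
  rewrite gE; last exact: sD.
  rewrite (nprod_far us2 qfar) /gauss [leRHS]mulrAC.
  apply: ler_wpM2r; first by rewrite invr_ge0 ltW ?gprod_gt0.
  rewrite -mulrA ler_wpM2l//; apply: nprod_schwarz => //.
  by rewrite cnormBC (le_trans zs)// ltW.
apply/negP; rewrite -ltNge gu; apply: (@le_lt_trans _ _ (M * (cnorm (u - z) / s2))).
  by rewrite ler_wpM2r// divr_ge0 ?cnorm_ge0 ?ltW.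
by move: uz; rewrite ltr_pdivlMr// mulrA ltr_pdivrMr// mulrC.
Qed.
End Approx.

(** * Integral powers, written as quotients of natural powers *)

Section PowerQuotients.
Variable R : realType.
Implicit Types (p q y : R).

Lemma expr_quot_ge p y (a b k : nat) : 0 < p <= 1 -> p <= y <= p^-1 ->
  (a <= b + k)%N -> (b <= a + k)%N -> p ^+ k <= y ^+ a / y ^+ b.
Proof.
move=> /andP[p0 p1] /andP[py yp] ab ba; have y0 : 0 < y by apply: lt_le_trans py.
have dec (m n : nat) : (m <= n)%N -> p ^+ n <= p ^+ m.
  by move=> mn; apply: ler_wiXn2l => //; exact: ltW.
have [h|h] := leqP b a.
  rewrite -(subnK h) exprD mulfK ?expf_neq0 ?gt_eqF//.
  apply: (@le_trans _ _ (p ^+ (a - b))); first by rewrite dec// leq_subLR.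
  by rewrite lerXn2r// nnegrE ltW.
rewrite -(subnK (ltnW h)) exprD invfM mulrCA divff ?expf_neq0 ?gt_eqF// mulr1.
apply: (@le_trans _ _ (p ^+ (b - a))); first by rewrite dec// leq_subLR.
rewrite -[p ^+ _]invrK lef_pV2 ?posrE ?invr_gt0 ?exprn_gt0// -exprVn.
by rewrite lerXn2r// nnegrE ?invr_ge0 ltW.
Qed.

Lemma expr_quot_lt y (a b k : nat) : 1 < y -> y ^+ a / y ^+ b < y ^+ k -> (a <= b + k)%N.
Proof.
move=> y1; rewrite ltr_pdivrMr ?exprn_gt0 ?(lt_trans _ y1)// -exprD ltr_eXn2l//.
by move=> /ltnW; rewrite addnC.
Qed.

(* Integral powers of [q] leave a gap around 1, into which small nontrivial
   powers of a [y] close to 1 fall. *)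
Lemma expr_gap y q (a b c d : nat) : 1 < y -> 1 < q -> y ^+ (a + b) < q ->
  y ^+ a * q ^+ d = y ^+ b * q ^+ c -> a = b.
Proof.
wlog ab : a b c d / (a <= b)%N.
  move=> W y1 q1 yq e; have [h|/ltnW h] := leqP a b; first exact: (W a b c d).
  by apply/esym; apply: (W b a d c) => //; rewrite addnC.
move=> y1 q1 yq; rewrite -{1}(subnK ab) exprD [y ^+ (b - a) * _]mulrC -mulrA.
have y0 : 0 < y by lra.
have q0 : 0 < q by lra.
move=> /mulfI; rewrite expf_neq0 ?gt_eqF// => /(_ isT) e.
apply/eqP; rewrite eqn_leq ab /= leqNgt; apply/negP => lab.
have ba0 : (0 < b - a)%N by rewrite subn_gt0.
have cd : (c < d)%N.
  rewrite -(ltr_eXn2l q1) e -[ltLHS]mul1r ltr_pM2r ?exprn_gt0//.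
  by rewrite exprn_egt1// -lt0n.
move: e; rewrite -(subnK cd) -addSnnS exprD => /mulIf.
rewrite expf_neq0 ?gt_eqF// => /(_ isT) e.
have : q <= y ^+ (b - a) by rewrite -e exprS ler_peMr ?exprn_ege1// ltW.
apply/negP; rewrite -ltNge; apply: le_lt_trans yq.
by rewrite ler_weXn2l ?ltW// (leq_trans (leq_subr _ _)) ?leq_addl.
Qed.

End PowerQuotients.

(** * Moduli of nonvanishing functions on discs, circles and annuli *)

Section Units.
Variables (R : realType) (K : ultraClosedFieldType R).
Implicit Types (A D : set K) (x y z w t : K) (l q : seq K) (r s c e d : R).
Implicit Types (f g h : K -> K) (u : K -> R).
Hypothesis nontriv : exists w : K, 0 < cnorm w < 1.

(** Every point of an open disc is a centre: recentred at the point of smaller modulus,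
    [zero_in_disc] would produce a zero. *)
Lemma constant_on_disc x r h z1 z2 : approx (oball x r) h ->
  (forall z, oball x r z -> h z != 0) -> oball x r z1 -> oball x r z2 ->
  cnorm (h z1) = cnorm (h z2).
Proof.
move=> hD h0; wlog lt12 : z1 z2 / cnorm (h z1) < cnorm (h z2).
  move=> W z1D z2D; have [k|k|//] := ltgtP (cnorm (h z1)) (cnorm (h z2)).
    by rewrite (W z1 z2).
  by rewrite (W z2 z1).
move=> z1D z2D; have e := oball_recenter z1D; rewrite -e in hD h0 z2D.
by have [z /h0 + hz] := zero_in_disc nontriv hD z2D lt12; rewrite hz eqxx.
Qed.

(** For distinct points, the two open discs are their residue classes in the closed disc of radius
    [cnorm (z1 - z2)]; for equal points they are empty. *)
Definition circle_adjacent A z1 z2 :=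
  oball z1 (cnorm (z1 - z2)) `<=` A /\ oball z2 (cnorm (z1 - z2)) `<=` A.

(** The residue class of [z] on its circle about [x] lies in [A]; other classes of the circle may
    meet holes. *)
Definition generic A x z := oball z (cnorm (z - x)) `<=` A.

Definition annulus_adjacent A x z1 z2 :=
  [/\ 0 < cnorm (z1 - x) < cnorm (z2 - x), generic A x z1, generic A x z2 &
      forall w, cnorm (z1 - x) < cnorm (w - x) < cnorm (z2 - x) -> A w].

Lemma annulus_generic A x z1 z2 w : annulus_adjacent A x z1 z2 ->
  cnorm (z1 - x) < cnorm (w - x) < cnorm (z2 - x) -> generic A x w.
Proof. by move=> [_ _ _ h] hw u uw; apply: h; rewrite (cdist_iso (uw : cnorm (u - w) < _)). Qed.

Definition circle_invariant (T : Type) A (u : K -> T) :=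
  forall z1 z2, circle_adjacent A z1 z2 -> u z1 = u z2.

(** The integral exponent is [a - b]. The bounding circles are included, but only at their generic
    points, since they may carry holes. *)
Definition annulus_power A u :=
  forall x z1 z2, annulus_adjacent A x z1 z2 ->
  exists C (a b : nat), forall z,
    cnorm (z1 - x) <= cnorm (z - x) <= cnorm (z2 - x) -> generic A x z ->
    u z = C * cnorm (z - x) ^+ a / cnorm (z - x) ^+ b.

Section Nonvanishing.
Variables (A : set K) (h : K -> K).
Hypotheses (hA : approx A h) (h0 : forall z, A z -> h z != 0).

Lemma approx_regular g z r e : oball z r `<=` A ->
  (forall v, A v -> cnorm (h v - g v) <= e) -> e < cnorm (h z) ->
  forall v, oball z r v -> cnorm (g v) = cnorm (h z).
Proof.
move=> zA hg ez v vz; have zz : oball z r z by apply: oballxx; exact: (le_lt_trans (cnorm_ge0 _) vz).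
have hv : cnorm (h v) = cnorm (h z).
  by apply: (constant_on_disc (approx_sub zA hA)) vz zz => w /zA; exact: h0.
by rewrite -hv; apply: near_cnorm (hg _ (zA _ vz)) _; rewrite hv.
Qed.

(** The modulus of [h] is constant on the residue class of [z], so an approximant of precision below
    [cnorm (h z)] has no zeros there and [gauss_regular] applies. *)
Lemma approx_gauss g c l q x z e : modulus_on A g c l q ->
  (forall v, A v -> cnorm (h v - g v) <= e) -> e < cnorm (h z) ->
  x != z -> generic A x z -> cnorm (h z) = gauss c l q x (cnorm (z - x)).
Proof.
move=> gM hg ez xz zA; have r0 : 0 < cnorm (z - x) by rewrite cnorm_gt0 subr_eq0 eq_sym.
have reg := approx_regular zA hg ez.
rewrite -(reg z); last exact: oballxx.
apply: (gauss_regular gM r0 zA (lexx _)) => v /reg gv.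
rewrite -cnorm_gt0 gv cnorm_gt0; apply: h0; exact/zA/oballxx.
Qed.

(** Both moduli are the Gauss norm of one approximant, with centre [z2] and radius
    [cnorm (z1 - z2)]. *)
Lemma nonvanishing_circle : circle_invariant A (fun z => cnorm (h z)).
Proof.
move=> z1 z2 [D1 D2]; have [->//|z12] := eqVneq z1 z2.
have r0 : 0 < cnorm (z1 - z2) by rewrite cnorm_gt0 subr_eq0.
have p1 : 0 < cnorm (h z1) by rewrite cnorm_gt0; exact/h0/D1/oballxx.
have p2 : 0 < cnorm (h z2) by rewrite cnorm_gt0; exact/h0/D2/oballxx.
pose e := Num.min (cnorm (h z1)) (cnorm (h z2)) / 2.
have m0 : 0 < Num.min (cnorm (h z1)) (cnorm (h z2)) by rewrite lt_min p1.
have e0 : 0 < e by rewrite divr_gt0.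
have [g gA hg] := hA e0.
have [c [l [q gM]]] := rational_modulus gA.
have me : e < Num.min (cnorm (h z1)) (cnorm (h z2)) by rewrite /e; lra.
have /andP[e1 e2] : (e < cnorm (h z1)) && (e < cnorm (h z2)) by rewrite -lt_min.
rewrite (approx_gauss gM hg e1 (x := z2))//; last by rewrite eq_sym.
have reg := approx_regular D2 hg e2.
rewrite -(reg z2); last exact: oballxx.
symmetry; apply: (gauss_regular gM r0 D2); first by rewrite subrr cnorm0 ltW.
by move=> v /reg gv; rewrite -cnorm_gt0 gv.
Qed.

(* An approximant has no zeros in the annulus once [h] is bounded below there.
   The Gauss norms of approximants are log-convex in the radius, so a tangent
   at an inner radius [r1] bounds them below; its slope is controlled by the
   values at [r] and [s], which do not depend on the approximant. *)
Lemma nonvanishing_annulus : annulus_power A (fun z => cnorm (h z)).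
Proof.
move=> x z1 z2 adj; have [/andP[r0 rs] G1 G2 inA] := adj.
set r := cnorm (z1 - x) in r0 rs inA *; set s := cnorm (z2 - x) in rs inA *.
have s0 : 0 < s by apply: lt_trans rs.
have hA0 z : x != z -> generic A x z -> 0 < cnorm (h z).
  move=> xz gz; rewrite cnorm_gt0; apply/h0/gz/oballxx.
  by rewrite cnorm_gt0 subr_eq0 eq_sym.
have neq z : r <= cnorm (z - x) -> x != z.
  by apply: contraTneq => <-; rewrite subrr cnorm0 -ltNge.
have [w0 [rw ws]] : exists w, r < cnorm (w - x) /\ cnorm (w - x) < s.
  have [w /andP[? ?]] := cnorm_dense nontriv r0 rs.
  by exists (w + x); rewrite addrK.
set r1 := cnorm (w0 - x) in rw ws.
have r10 : 0 < r1 by apply: lt_trans rw.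
have Gw : generic A x w0 by apply: annulus_generic adj _; rewrite rw.
have p1 := hA0 _ (neq _ (lexx _)) G1.
have p2 := hA0 _ (neq _ (ltW rs)) G2.
have pw := hA0 _ (neq _ (ltW rw)) Gw.
pose m := Num.min (cnorm (h w0)) (Num.min (cnorm (h z1)) (cnorm (h z2))).
have m0 : 0 < m by rewrite !lt_min p1 p2 pw.
have [k1 hk1] : exists k, cnorm (h z1) / cnorm (h w0) < (r1 / r) ^+ k.
  by apply: exprn_gt1_unbounded; rewrite ltr_pdivlMr// mul1r.
have [k2 hk2] : exists k, cnorm (h z2) / cnorm (h w0) < (s / r1) ^+ k.
  by apply: exprn_gt1_unbounded; rewrite ltr_pdivlMr// mul1r.
pose k := maxn k1 k2.
have qaff g c l q : modulus_on A g c l q ->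
    {in q, forall t, (cnorm (x - t) <= r) || (s <= cnorm (x - t))}.
  move=> [_ qA _] t /qA tA; rewrite leNgt [X in _ || X]leNgt -negb_and.
  by apply/negP => xt; apply/tA/inA; rewrite cnormBC.
pose b0 := cnorm (h w0) * (r / s) ^+ k.
have b00 : 0 < b0 by rewrite mulr_gt0 ?exprn_gt0 ?divr_gt0.
have lower g c l q (t : R) : modulus_on A g c l q ->
    (forall v, A v -> cnorm (h v - g v) <= m / 2) -> r <= t <= s ->
    b0 <= gauss c l q x t.
  move=> gM hg rts; have mm : m / 2 < m by lra.
  have /and3P[mw mz1 mz2] : [&& m / 2 < cnorm (h w0), m / 2 < cnorm (h z1) & m / 2 < cnorm (h z2)].
    by move: mm; rewrite {2}/m !lt_min.
  have ew := approx_gauss gM hg mw (neq _ (ltW rw)) Gw.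
  have e1 := approx_gauss gM hg mz1 (neq _ (lexx _)) G1.
  have e2 := approx_gauss gM hg mz2 (neq _ (ltW rs)) G2.
  rewrite -/r1 in ew; rewrite -/r in e1; rewrite -/s in e2.
  pose a := count (fun t => cnorm (x - t) <= r1) l.
  pose b := count (fun t => cnorm (x - t) <= r) q.
  (* No pole lies in the open annulus, so the denominator is exactly a power of the radius and only
     the numerator needs the tangent inequality; [a - b] is the slope at [r1]. *)
  have tangent v : r <= v <= s -> cnorm (h w0) * ((v / r1) ^+ a / (v / r1) ^+ b) <= gauss c l q x v.
    move=> rvs; have v0 : 0 < v by apply: lt_le_trans r0 _; case/andP: rvs.
    have rr1s : r <= r1 <= s by rewrite !ltW.
    rewrite ew /gauss (gprod_affine r0 rvs (qaff _ _ _ _ gM)).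
    rewrite (gprod_affine r0 rr1s (qaff _ _ _ _ gM)) -/b.
    have [c0 _ _] := gM; have q0 := gprod_gt0 q x r0.
    have -> : c * gprod l x r1 / (gprod q x r * (r1 / r) ^+ b) * ((v / r1) ^+ a / (v / r1) ^+ b)
      = c * (gprod l x r1 * (v / r1) ^+ a) / (gprod q x r * (v / r) ^+ b).
      rewrite !expr_div_n; field.
      by rewrite !expf_neq0 ?gt_eqF.
    apply: ler_wpM2r; first by rewrite invr_ge0 mulr_ge0 ?exprn_ge0 ?divr_ge0 ?ltW.
    by apply: ler_wpM2l => //; exact: gprod_tangent.
  have kmono (y : R) : 1 < y -> y ^+ k1 <= y ^+ k /\ y ^+ k2 <= y ^+ k.
    by move=> y1; rewrite !ler_weXn2l ?ltW// ?leq_maxl ?leq_maxr.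
  (* The tangent at [r1] stays below the known value at [s], which bounds its slope above; the value
     at [r] bounds it below. *)
  have ab : (a <= b + k)%N.
    have y1 : 1 < s / r1 by rewrite ltr_pdivlMr// mul1r.
    apply: (expr_quot_lt y1); apply: lt_le_trans (kmono _ y1).2.
    apply: le_lt_trans hk2; rewrite ler_pdivlMr// mulrC e2.
    by apply: tangent; rewrite lexx ltW.
  have ba : (b <= a + k)%N.
    have y1 : 1 < r1 / r by rewrite ltr_pdivlMr// mul1r.
    apply: (expr_quot_lt y1); apply: lt_le_trans (kmono _ y1).1.
    apply: le_lt_trans hk1; rewrite ler_pdivlMr// mulrC e1.
    have -> : (r1 / r) ^+ b / (r1 / r) ^+ a = (r / r1) ^+ a / (r / r1) ^+ b.
      by rewrite -[r / r1]invf_div !exprVn invrK mulrC.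
    by apply: tangent; rewrite lexx ltW.
  apply: le_trans (tangent _ rts); rewrite ler_pM2l//.
  have /andP[rt ts] := rts; apply: expr_quot_ge => //.
    by rewrite divr_gt0//= ler_pdivrMr// mul1r ltW.
  have t0 := lt_le_trans r0 rt; rewrite invf_div; apply/andP; split; apply: ler_pM;
    by rewrite ?invr_ge0 ?lef_pV2 ?posrE ?(ltW r0) ?(ltW s0) ?(ltW r10) ?(ltW t0) ?(ltW ws) ?(ltW rw).
(* The approximant depends on [z] here, but the bound [b0] does not. *)
have h_ge z : r <= cnorm (z - x) <= s -> generic A x z -> b0 <= cnorm (h z).
  move=> rzs gz; have /andP[rz zs] := rzs.
  have hz := hA0 _ (neq _ rz) gz.
  have e0 : 0 < Num.min (m / 2) (cnorm (h z) / 2) by rewrite lt_min !divr_gt0.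
  have [g gA hg] := hA e0; have [c [l [q gM]]] := rational_modulus gA.
  rewrite (approx_gauss gM hg _ (neq _ rz) gz).
    by apply: (lower _ _ _ _ _ gM) => // v /hg /le_trans; apply; rewrite ge_min lexx.
  by apply: (@le_lt_trans _ _ (cnorm (h z) / 2)); [rewrite ge_min lexx orbT|lra].
pose e := Num.min (m / 2) (b0 / 2).
have e0 : 0 < e by rewrite lt_min !divr_gt0.
have eb : e < b0 by rewrite gt_min [b0 / 2 < _]ltr_pdivrMr// mulr2n; apply/orP; right; lra.
have [g gA hg] := hA e0.
have [c [l [q gM]]] := rational_modulus gA.
(* A zero of [g] in the open annulus would contradict [h_ge], as the precision of [g] is below
   [b0]. *)
have laff : {in l, forall t, (cnorm (x - t) <= r) || (s <= cnorm (x - t))}.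
  move=> t tl; rewrite leNgt [X in _ || X]leNgt -negb_and cnormBC; apply/negP => xt.
  have ht : b0 <= cnorm (h t).
    apply: h_ge; last exact: annulus_generic adj xt.
    by case/andP: xt => /ltW -> /ltW ->.
  have := near_cnorm (hg _ (inA _ xt)) (lt_le_trans eb ht).
  rewrite (modulus_root gM (inA _ xt) tl) cnorm0 => h00.
  by move: (lt_le_trans b00 ht); rewrite -h00 ltxx.
pose a := count (fun t => cnorm (x - t) <= r) l.
pose b := count (fun t => cnorm (x - t) <= r) q.
exists (gauss c l q x r * r ^+ b / r ^+ a), a, b => z /andP[rz zs] gz.
have rzs : r <= cnorm (z - x) <= s by rewrite rz.
rewrite (approx_gauss gM hg _ (neq _ rz) gz); last by apply: lt_le_trans eb _; exact: h_ge.
rewrite /gauss (gprod_affine r0 rzs laff) (gprod_affine r0 rzs (qaff _ _ _ _ gM)) -/a -/b.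
rewrite !expr_div_n; field.
have /gt_eqF -> : 0 < gprod q x r by exact: gprod_gt0.
by rewrite !expf_neq0 ?gt_eqF ?(lt_le_trans r0).
Qed.

End Nonvanishing.
End Units.

(** * Affinoids and their connectedness by circles and annuli *)

Section Affinoids.
Variables (R : realType) (K : ultraClosedFieldType R).
Implicit Types (A : set K) (x y z w t : K).

Lemma affinoidP A : affinoid A ->
  exists (a : K) (r : R) (n : nat) (c : 'I_n -> K) (s : 'I_n -> R),
    0 < r /\ (forall i, 0 < s i) /\
    forall z, A z <-> cnorm (z - a) <= r /\ forall i, s i <= cnorm (z - c i).
Proof.
move=> [B [n [Bs [[a [r [[w w0 rE] BE]] hBs AE]]]]].
have vg_gt0 (s : R) : value_group K s -> 0 < s by move=> [u u0 <-]; rewrite cnorm_gt0.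
have /choice[c /choice[s hs]] : forall i, exists a' r', value_group K r' /\ Bs i = [set z | cnorm (z - a') < r'].
  by move=> i; have := hBs i.
exists a, r, n, c, s; split; first by rewrite -rE cnorm_gt0.
split=> [i|z]; first exact/vg_gt0/(hs i).1.
rewrite AE BE; split=> [[za zB]|[za zB]]; split=> //; first move=> i.
  by rewrite leNgt; apply/negP => zi; apply: zB; exists i => //; rewrite (hs i).2.
by move=> [i _]; rewrite (hs i).2 /= ltNge zB.
Qed.

Lemma affinoid_open A y : affinoid A -> A y -> exists2 d : R, 0 < d & oball y d `<=` A.
Proof.
move=> /affinoidP[a [r [n [c [s [r0 [s0 AE]]]]]]] /AE[ya yc].
have [d [d0 dr ds]] : exists d : R, [/\ 0 < d, d <= r & {in enum 'I_n, forall i, d <= s i}].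
  elim: (enum _) => [|i l [d [d0 dr dl]]]; first by exists r.
  exists (Num.min (s i) d); split; first by rewrite lt_min s0.
    by rewrite ge_min dr orbT.
  by move=> j; rewrite inE => /orP[/eqP->|/dl dj]; rewrite ge_min ?lexx ?dj ?orbT.
exists d => // z zy; apply/AE; split=> [|i].
  by apply: (@cdist_le _ _ y) ya; apply: (le_trans (ltW zy)).
rewrite leNgt; apply/negP => zs; have := yc i; rewrite leNgt => /negP; apply.
by apply: (cdist_lt _ zs); rewrite cnormBC (lt_le_trans zy)// ds// mem_enum.
Qed.

(* Circles about [x] grow from radius 0; they meet the holes only at the radii
   [cnorm (x - c i)], which are crossed one at a time. *)
Lemma affinoid_connected (T : Type) A (v : K -> T) : affinoid A ->
  circle_invariant A v ->
  (forall x z1 z2, annulus_adjacent A x z1 z2 -> v z1 = v z2) ->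
  forall x y, A x -> A y -> v x = v y.
Proof.
move=> /affinoidP[a [r [n [c [s [r0 [s0 AE]]]]]]] circ ann.
(* All points of a hole are equally far from a point [x] of [A]. *)
have hole x u i : A x -> cnorm (u - c i) < s i -> cnorm (u - x) = cnorm (x - c i).
  move=> /AE[_ xc] us; have := @cdist_iso _ _ (c i) u x; rewrite (cnormBC _ x).
  by apply; apply: lt_le_trans (xc i).
have inA x u : A x -> cnorm (u - x) <= r -> (forall i, s i <= cnorm (u - c i)) -> A u.
  by move=> /AE[xa _] ux uc; apply/AE; split=> //; apply: (cdist_le ux).
have gen x z : A x -> cnorm (z - x) <= r -> (forall i, cnorm (z - x) <= cnorm (z - c i)) ->
    generic A x z.
  move=> Ax zr zc u uz; have ux : cnorm (u - x) <= cnorm (z - x).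
    by apply: (@cdist_le _ _ z) => //; exact: ltW.
  apply: (inA x) => // [|i]; first exact: le_trans zr.
  rewrite leNgt; apply/negP => us.
  have e1 : cnorm (u - c i) = cnorm (z - c i) by apply: cdist_iso; apply: lt_le_trans (zc i).
  have e2 := hole _ _ _ Ax us.
  have [_ xc] : cnorm (x - a) <= r /\ forall i, s i <= cnorm (x - c i) by apply/AE.
  have := zc i; rewrite -e1; apply/negP; rewrite -ltNge; apply: (lt_le_trans us).
  by apply: (le_trans (xc i)); rewrite -e2.
(* Induction on the number of centres [c i] closer to [x] than [z]. If there are none, the open disc
   about [x] up to [z] lies in [A] and one circle suffices. *)
have reach k : forall x z, A x -> 0 < cnorm (z - x) <= r ->
    (forall i, cnorm (z - x) <= cnorm (z - c i)) ->
    (#|[pred i | (cnorm (x - c i) < cnorm (z - x))%R]| <= k)%N -> v x = v z.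
  elim: k => [|k IH] x z Ax /andP[z0 zr] zc hk.
    apply: circ; split; last first.
      by rewrite cnormBC; exact: gen.
    rewrite cnormBC => u ux; apply: (inA x) => // [|i].
      by apply: le_trans zr; exact: ltW.
    rewrite leNgt; apply/negP => us.
    move: hk; rewrite leqn0 => /eqP/card0_eq/(_ i); rewrite !inE => /negbT/negP; apply.
    by rewrite -(hole _ _ _ Ax us).
  have [/existsP[i0 Pi0]|/existsPn no] := boolP [exists i, cnorm (x - c i) < cnorm (z - x)]; last first.
    apply: IH => //; first by rewrite z0.
    by rewrite eq_card0// => i; rewrite !inE (negbTE (no i)).
  (* No hole is met strictly between this radius and that of [z]. A generic [z'] at this radius is
     joined to [z] by an annulus, and [i] no longer counts for [z']. *)
  pose i := [arg max_(i > i0 | cnorm (x - c i) < cnorm (z - x)) cnorm (x - c i)]%O.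
  have [Pi imax] : cnorm (x - c i) < cnorm (z - x) /\
      forall j, cnorm (x - c j) < cnorm (z - x) -> cnorm (x - c j) <= cnorm (x - c i).
    by rewrite /i; case: arg_maxP.
  have [_ xc] : cnorm (x - a) <= r /\ forall i, s i <= cnorm (x - c i) by apply/AE.
  have w0 : x - c i != 0 by rewrite -cnorm_gt0; apply: lt_le_trans (xc i).
  have [z' [z'x z'c]] := separated_point [seq c i | i <- enum 'I_n] x w0.
  have {}z'c j : cnorm (z' - x) <= cnorm (z' - c j).
    by rewrite z'x; apply/z'c/map_f; rewrite mem_enum.
  have z'r : cnorm (z' - x) <= r by rewrite z'x (le_trans (ltW Pi)).
  rewrite (IH x z')//.
  - apply: (ann x); split.
    + by rewrite z'x Pi cnorm_gt0 w0.
    + exact: gen.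
    + exact: gen.
    + move=> w /andP[w1 w2]; apply: (inA x) => // [|j].
        by apply: le_trans zr; exact: ltW.
      rewrite leNgt; apply/negP => ws; move: w1 w2; rewrite (hole _ _ _ Ax ws).
      by move=> w1 /imax; rewrite leNgt -z'x w1.
  - by rewrite z'x cnorm_gt0 w0 -z'x.
  - rewrite -ltnS; apply: leq_trans hk; apply: proper_card; apply/properP; split.
      by apply/fintype.subsetP => j; rewrite !inE z'x => /lt_trans; apply.
    by exists i; rewrite !inE ?Pi// z'x ltxx.
move=> x y Ax Ay; have [->//|xy] := eqVneq x y.
have w0 : y - x != 0 by rewrite subr_eq0 eq_sym.
(* The residue class of [y] may contain a hole; [z] avoids all holes and is equally far from [x] and
   [y], so each of them is joined to it. *)
have [z [zx zc]] := separated_point (y :: [seq c i | i <- enum 'I_n]) x w0.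
have zi i : cnorm (y - x) <= cnorm (z - c i).
  by apply: zc; rewrite inE map_f ?orbT// mem_enum.
have yxr : cnorm (y - x) <= r.
  have [/AE[xa _] /AE[ya _]] := (Ax, Ay).
  by apply: (cdist_le ya); rewrite cnormBC.
have zy : cnorm (z - y) = cnorm (y - x).
  apply/eqP; rewrite eq_le zc ?mem_head// andbT.
  by apply: (@cdist_le _ _ x); rewrite ?zx// cnormBC.
rewrite (reach _ x z Ax _ _ (leqnn _)) ?zx ?cnorm_gt0 ?w0//.
by rewrite (reach _ y z Ay _ _ (leqnn _)) ?zy ?cnorm_gt0 ?w0.
Qed.

End Affinoids.

(** * Separation of variables for symmetric functions *)

Section Symmetric.
Variables (R : realType) (K : ultraClosedFieldType R).
Implicit Types (x y z w t : K).
Hypothesis nontriv : exists w : K, 0 < cnorm w < 1.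
Variables (A : set K) (M : K -> K -> R).
Hypotheses (M_gt0 : forall x y, A x -> A y -> 0 < M x y)
  (M_sym : forall x y, M x y = M y x)
  (M_circ : forall y, A y -> circle_invariant A (M^~ y))
  (M_ann : forall y, A y -> annulus_power A (M^~ y)).

(** The ratio depends only on the slope in the first variable, so the slopes at [w1] and [w2] have
    to agree. For [z] close to the inner circle, the cross ratio of [M] at [z1], [z] and [w1], [w2]
    is a power of [cnorm (z - x) / r] whose exponent is the difference of these slopes, and by
    symmetry also an integral power of [u2 / u1]; [expr_gap] makes the difference zero. *)
Lemma annulus_rectangle x z1 z2 x' w1 w2 :
  annulus_adjacent A x z1 z2 -> annulus_adjacent A x' w1 w2 ->
  M z1 w1 / M z2 w1 = M z1 w2 / M z2 w2.
Proof.
move=> adjz adjw; have [/andP[r0 rs] G1 G2 _] := adjz.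
have [/andP[s0 st] H1 H2 _] := adjw.
have [Az1 Az2] : A z1 /\ A z2 by split; [apply/G1|apply/G2]; apply/oballxx => //; exact: lt_trans rs.
have [Aw1 Aw2] : A w1 /\ A w2 by split; [apply/H1|apply/H2]; apply/oballxx => //; exact: lt_trans st.
have [C1 [a1 [b1 E1]]] := M_ann Aw1 adjz.
have [C2 [a2 [b2 E2]]] := M_ann Aw2 adjz.
set r := cnorm (z1 - x) in r0 rs E1 E2 *; set s := cnorm (z2 - x) in rs E1 E2 *.
have sg0 : 0 < s by apply: lt_trans rs.
have ab : (a1 + b2 = a2 + b1)%N.
  pose u1 := cnorm (w1 - x'); pose u2 := cnorm (w2 - x').
  have u20 : 0 < u2 by apply: lt_trans st.
  have q1 : 1 < u2 / u1 by rewrite ltr_pdivlMr// mul1r.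
  (* The exponents in the first variable are known before [z] is chosen. Those in the second depend
     on [z], but [expr_gap] needs no bound on them. *)
  have [y0 y01 y0q] := exprn_near1 ((a1 + b2) + (a2 + b1)) q1.
  have [z [rz zs zy]] : exists z, [/\ r < cnorm (z - x), cnorm (z - x) < s & cnorm (z - x) < r * y0].
    have [|w /andP[rw]] := @cnorm_dense _ _ nontriv r (Num.min s (r * y0)) r0.
      by rewrite lt_min rs ltr_pMr.
    by rewrite lt_min => /andP[? ?]; exists (w + x); rewrite addrK.
  have Gz : generic A x z by apply: annulus_generic adjz _; rewrite rz.
  have z0 : 0 < cnorm (z - x) by apply: lt_trans rz.
  have Az : A z by apply/Gz/oballxx.
  have [C [c1 [d1 F1]]] := M_ann Az1 adjw.
  have [C' [c2 [d2 F2]]] := M_ann Az adjw.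
  have y1 : 1 < cnorm (z - x) / r by rewrite ltr_pdivlMr// mul1r.
  apply: (@expr_gap _ (cnorm (z - x) / r) (u2 / u1) _ _ (d2 + c1) (c2 + d1)) => //.
    apply: le_lt_trans y0q; rewrite lerXn2r ?nnegrE ?ltW//; try lra.
    by rewrite ltr_pdivrMr// mulrC.
  have P0 : 0 < M z1 w1 * M z w2 by rewrite mulr_gt0 ?M_gt0.
  have Q0 : 0 < M z1 w2 * M z w1 by rewrite mulr_gt0 ?M_gt0.
  have eY : (cnorm (z - x) / r) ^+ (a1 + b2) * (M z1 w1 * M z w2)
          = (cnorm (z - x) / r) ^+ (a2 + b1) * (M z1 w2 * M z w1).
    rewrite !E1 ?E2 ?lexx ?(ltW rs) ?(ltW rz) ?(ltW zs)// -/r.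
    rewrite !expr_div_n !exprD; field.
    by rewrite !expf_neq0 ?gt_eqF.
  have eQ : (u2 / u1) ^+ (d2 + c1) * (M z1 w1 * M z w2)
          = (u2 / u1) ^+ (c2 + d1) * (M z1 w2 * M z w1).
    rewrite !(M_sym z1) !(M_sym z) !F1 ?F2 ?lexx ?(ltW st)//.
    rewrite -/u1 -/u2 !expr_div_n !exprD; field.
    by rewrite !expf_neq0 ?gt_eqF.
  have : 0 < (M z1 w1 * M z w2) * (M z1 w2 * M z w1) by rewrite mulr_gt0.
  move: eY eQ; set P := _ * M z w2; set Q := _ * M z w1; set Y := _ ^+ _; set Y' := _ ^+ (a2 + b1).
  set U := _ ^+ (d2 + c1); set U' := _ ^+ (c2 + d1) => eY eQ PQ.
  apply: (mulIf (x := P * Q)); first by rewrite gt_eqF.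
  have -> : Y * U' * (P * Q) = (Y * P) * (U' * Q) by ring.
  by rewrite eY -eQ; ring.
have p1 := M_gt0 Az2 Aw1; have p2 := M_gt0 Az2 Aw2.
apply/eqP; rewrite eqr_div ?(lt0r_neq0 p1) ?(lt0r_neq0 p2)//; apply/eqP.
rewrite !E1 ?E2 ?lexx ?(ltW rs)// -/r -/s.
have e (v : R) : v ^+ a1 * v ^+ b2 = v ^+ a2 * v ^+ b1 by rewrite -!exprD ab.
transitivity (C1 * C2 * (r ^+ a1 * r ^+ b2) * (s ^+ a2 * s ^+ b1)
    / (r ^+ b1 * r ^+ b2 * s ^+ b1 * s ^+ b2)).
  by field; rewrite !expf_neq0 ?gt_eqF.
rewrite (e r) -(e s); field.
by rewrite !expf_neq0 ?gt_eqF.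
Qed.

(** Connectedness is used in each variable in turn: first for [w] in [M z1 w / M z2 w] with [z1],
    [z2] joined by an annulus, then for [z] in [M z y / M z y']. *)
Lemma symmetric_cross_ratio : affinoid A -> forall x x' y y',
  A x -> A x' -> A y -> A y' -> M x y * M x' y' = M x y' * M x' y.
Proof.
move=> aff x x' y y' Ax Ax' Ay Ay'.
have circ z : A z -> circle_invariant A (M z).
  by move=> Az u v /(M_circ Az); rewrite !(M_sym z).
have inA z1 z2 x0 : annulus_adjacent A x0 z1 z2 -> A z1 /\ A z2.
  move=> [/andP[r0 rs] G1 G2 _]; split; [apply/G1|apply/G2]; apply/oballxx => //; exact: lt_trans rs.
have : M x y / M x y' = M x' y / M x' y'.
  apply: (affinoid_connected (v := fun z => M z y / M z y') aff) => //.
    by move=> u v uv; rewrite (M_circ Ay uv) (M_circ Ay' uv).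
  move=> x0 z1 z2 adj; have [Az1 Az2] := inA _ _ _ adj.
  have : M z1 y / M z2 y = M z1 y' / M z2 y'.
    apply: (affinoid_connected (v := fun w => M z1 w / M z2 w) aff) => //.
      by move=> u v uv; rewrite (circ _ Az1 _ _ uv) (circ _ Az2 _ _ uv).
    move=> x1 w1 w2 adjw; exact: (annulus_rectangle adj adjw).
  move/eqP; rewrite eqr_div ?lt0r_neq0 ?M_gt0// => /eqP e.
  by apply/eqP; rewrite eqr_div ?lt0r_neq0 ?M_gt0// e mulrC.
by move/eqP; rewrite eqr_div ?lt0r_neq0 ?M_gt0// => /eqP ->; exact: mulrC.
Qed.

End Symmetric.

(** * Divided differences and derivatives *)

Section DividedDifference.
Variables (R : realType) (K : ultraClosedFieldType R).
Implicit Types (A D : set K) (x y z w t : K) (f g h : K -> K) (e d : R).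

(** The value at [y] is left free; [deriv_divided_diff] identifies it when [h] is approximable
    around [y]. *)
Definition divided_diff A f y h :=
  forall x, A x -> x != y -> h x = (f x - f y) / (x - y).

Lemma rationalB A g h : rational_on A g -> rational_on A h ->
  rational_on A (fun z => g z - h z).
Proof.
move=> [P [Q PQ]] [P' [Q' PQ']]; exists (P * Q' - P' * Q), (Q * Q') => z Az.
have [[Q0 ->] [Q0' ->]] := (PQ z Az, PQ' z Az).
split; first by rewrite hornerM mulf_neq0.
by rewrite !hornerE; field; rewrite Q0 Q0'.
Qed.

Lemma rational_poly A (P : {poly K}) : rational_on A (horner P).
Proof. by exists P, 1 => z _; rewrite hornerC oner_eq0 divr1. Qed.

(** The numerator [Q.[y] *: P - P.[y] *: Q] of the difference vanishes at [y], so [X - y] divides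
    it. *)
Lemma rational_divided_diff A g y : rational_on A g -> A y ->
  exists2 h, rational_on A h & divided_diff A g y h.
Proof.
move=> [P [Q PQ]] Ay; have [Qy gy] := PQ y Ay.
pose N := Q.[y] *: P - P.[y] *: Q.
have /factor_theorem[S NS] : root N y by rewrite /root !hornerE mulrC subrr.
exists (fun x => S.[x] / (Q.[y] *: Q).[x]).
  exists S, (Q.[y] *: Q) => z /PQ[Qz _]; split=> //.
  by rewrite hornerZ mulf_neq0.
move=> x Ax xy; have [Qx ->] := PQ x Ax; rewrite gy hornerZ.
have xy0 : x - y != 0 by rewrite subr_eq0.
have NE : Q.[y] * P.[x] - P.[y] * Q.[x] = S.[x] * (x - y).
  by have := congr1 (horner^~ x) NS; rewrite !hornerE.
have -> : S.[x] = (Q.[y] * P.[x] - P.[y] * Q.[x]) / (x - y) by rewrite NE mulfK.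
by field; rewrite Qy Qx xy0.
Qed.

(** Where [cnorm (x - y)] is at least [cnorm w] the estimate is direct; the maximum principle
    carries it into the disc about [y]. *)
Lemma divided_diff_close A y w g g' h h' e : w != 0 -> A y -> cball y (cnorm w) `<=` A ->
  rational_on A h -> rational_on A h' -> divided_diff A g y h -> divided_diff A g' y h' ->
  (forall x, A x -> cnorm (g x - g' x) <= e) ->
  forall x, A x -> cnorm (h x - h' x) <= e / cnorm w.
Proof.
move=> w0 Ay wA hr h'r hd h'd gg'; have nw0 : 0 < cnorm w by rewrite cnorm_gt0.
have far x : A x -> cnorm w <= cnorm (x - y) -> cnorm (h x - h' x) <= e / cnorm w.
  move=> Ax xw; have x0 : 0 < cnorm (x - y) by apply: lt_le_trans xw.
  have xy : x != y by rewrite -subr_eq0 -cnorm_gt0.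
  rewrite hd// h'd// -mulrBl cnormM cnormV; apply: ler_pM; rewrite ?cnorm_ge0 ?invr_ge0 ?cnorm_ge0//.
    have -> : g x - g y - (g' x - g' y) = (g x - g' x) - (g y - g' y) by ring.
    by apply: cnormB_le; apply: gg'.
  by rewrite lef_pV2 ?posrE.
move=> x Ax; have [xw|/ltW xw] := leP (cnorm w) (cnorm (x - y)); first exact: far.
apply: (maximum_principle (rationalB hr h'r) w0 wA) xw => z zw.
by apply: far; rewrite ?zw//; apply: wA; rewrite /cball /= zw.
Qed.

(** The value of [h] at [y] is the limit of those of the divided differences of approximants, a
    Cauchy sequence by [divided_diff_close]. The bound is given for every approximant [g], so that
    it can later be applied to a chosen polynomial. *)
Lemma approx_divided_diff A y w f : w != 0 -> A y -> cball y (cnorm w) `<=` A ->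
  approx A f -> exists h, divided_diff A f y h /\
  forall g k e, 0 < e -> rational_on A g -> rational_on A k -> divided_diff A g y k ->
    (forall x, A x -> cnorm (f x - g x) <= e) ->
    forall x, A x -> cnorm (h x - k x) <= e / cnorm w.
Proof.
move=> w0 Ay wA fA; have nw0 : 0 < cnorm w by rewrite cnorm_gt0.
pose ep n : R := n.+1%:R^-1.
have ep0 n : 0 < ep n by rewrite invr_gt0.
have ep_le m n : (m <= n)%N -> ep n <= ep m by move=> mn; rewrite lef_pV2 ?posrE// ler_nat.
have ep_small e : 0 < e -> exists N, forall n, (N <= n)%N -> ep n <= e.
  move=> e0; exists (Num.trunc e^-1) => n Nn; apply: (le_trans (ep_le _ _ Nn)).
  by rewrite -[leRHS]invrK lef_pV2 ?posrE ?invr_gt0// ltW// truncnS_gt.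
have /choice[G hG] : forall n, exists gk : (K -> K) * (K -> K),
    [/\ rational_on A gk.1, rational_on A gk.2, divided_diff A gk.1 y gk.2 &
        forall x, A x -> cnorm (f x - gk.1 x) <= ep n].
  move=> n; have [g gA fg] := fA _ (ep0 n).
  by have [k kA gk] := rational_divided_diff gA Ay; exists (g, k).
have close n g k e : rational_on A g -> rational_on A k -> divided_diff A g y k ->
    (forall x, A x -> cnorm (f x - g x) <= e) -> ep n <= e ->
    forall x, A x -> cnorm ((G n).2 x - k x) <= e / cnorm w.
  move=> gA kA gk fg ne; have [Gr Gk Gd Gc] := hG n.
  apply: (divided_diff_close w0 Ay wA Gk kA Gd gk) => x Ax.
  by apply: (@cdist_le _ _ (f x)); [rewrite cnormBC (le_trans (Gc _ _))|exact: fg].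
have [|l hl] := @cauchy_seq_cvg _ _ (fun n => (G n).2 y).
  move=> e e0; have [N hN] := ep_small (e * cnorm w / 2) (divr_gt0 (mulr_gt0 e0 nw0) (ltr0Sn _ _)).
  exists N => m n Nm Nn; apply: (@le_lt_trans _ _ (ep N / cnorm w)).
    apply: (@cdist_le _ _ ((G N).2 y)).
      rewrite cnormBC; have [Gr Gk Gd Gc] := hG m; apply: (close _ _ _ _ Gr Gk Gd) => // x Ax.
      exact: le_trans (Gc x Ax) (ep_le _ _ Nm).
    have [Gr Gk Gd Gc] := hG n; apply: (close _ _ _ _ Gr Gk Gd) => // x Ax.
    exact: le_trans (Gc x Ax) (ep_le _ _ Nn).
  rewrite ltr_pdivrMr//; apply: le_lt_trans (hN _ (leqnn _)) _.
  by have := mulr_gt0 e0 nw0; lra.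
exists (fun x => if x == y then l else (f x - f y) / (x - y)); split.
  by move=> x _ /negbTE ->.
move=> g k e e0 gA kA gk fg x Ax; have [N1 h1] := ep_small _ e0.
have ew0 : 0 < e / cnorm w by rewrite divr_gt0.
have [->|xy] := eqVneq x y.
  have [N2 h2] := hl _ ew0; pose n := maxn N1 N2.
  apply: (@cdist_le _ _ ((G n).2 y)); first by rewrite cnormBC ltW// h2// leq_maxr.
  by apply: (close _ _ _ _ gA kA gk fg) => //; rewrite h1// leq_maxl.
have nxy : 0 < cnorm (x - y) by rewrite cnorm_gt0 subr_eq0.
have [N2 h2] := ep_small _ (mulr_gt0 ew0 nxy); pose n := maxn N1 N2.
apply: (@cdist_le _ _ ((G n).2 x)); last first.
  by apply: (close _ _ _ _ gA kA gk fg) => //; rewrite h1// leq_maxl.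
have [Gr Gk Gd Gc] := hG n.
rewrite Gd// -mulrBl cnormM cnormV ler_pdivrMr//; apply: le_trans (h2 n (leq_maxr _ _)).
have -> : f x - f y - ((G n).1 x - (G n).1 y) = (f x - (G n).1 x) - (f y - (G n).1 y) by ring.
by apply: cnormB_le; exact: Gc.
Qed.

Lemma approx_of_divided_diff A y w f h : w != 0 -> A y -> approx A f ->
  (forall g k e, 0 < e -> rational_on A g -> rational_on A k -> divided_diff A g y k ->
    (forall x, A x -> cnorm (f x - g x) <= e) ->
    forall x, A x -> cnorm (h x - k x) <= e / cnorm w) -> approx A h.
Proof.
move=> w0 Ay fA H e e0; have nw0 : 0 < cnorm w by rewrite cnorm_gt0.
have [g gA fg] := fA _ (mulr_gt0 e0 nw0).
have [k kA gk] := rational_divided_diff gA Ay; exists k => //.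
by have := H _ _ _ (mulr_gt0 e0 nw0) gA kA gk fg; rewrite mulfK ?gt_eqF.
Qed.

Lemma approx_bounded A y r h : approx A h -> 0 < r -> cball y r `<=` A ->
  exists2 C, 0 < C & forall x, cnorm (x - y) <= r -> cnorm (h x) <= C.
Proof.
move=> hA r0 rA; have [g gA hg] := hA _ ltr01.
have [C hC] := rational_bounded gA r0 rA.
exists (Num.max 1 C) => [|x xr]; first by rewrite lt_max ltr01.
rewrite -[h x]subr0; apply: (@cdist_le _ _ (g x)); first by rewrite le_max hg//; exact: rA.
by rewrite subr0 le_max hC ?orbT.
Qed.

(** The divided difference of [h] at [y] is approximable, hence bounded on the disc. *)
Lemma approx_lipschitz A y w h : w != 0 -> cball y (cnorm w) `<=` A -> approx A h ->
  exists2 C, 0 < C & forall x, cnorm (x - y) <= cnorm w -> cnorm (h x - h y) <= C * cnorm (x - y).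
Proof.
move=> w0 wA hA; have nw0 : 0 < cnorm w by rewrite cnorm_gt0.
have Ay : A y by apply: wA; rewrite /cball /= subrr cnorm0 ltW.
have [k [kd kH]] := approx_divided_diff w0 Ay wA hA.
have kA := approx_of_divided_diff w0 Ay hA kH.
have [C C0 hC] := approx_bounded kA nw0 wA; exists C => // x xw.
have [->|xy] := eqVneq x y; first by rewrite !subrr cnorm0 mulr0.
have nxy : 0 < cnorm (x - y) by rewrite cnorm_gt0 subr_eq0.
rewrite -ler_pdivrMr// -cnormV -cnormM -kd//; [exact: hC|exact: wA].
Qed.

Hypothesis nontriv : exists w : K, 0 < cnorm w < 1.

(** Properness is what makes the limit in [deriv_Cp] unique. *)
Lemma dnbhs0_proper : ProperFilter ((0 : K)^').
Proof.
apply: Build_ProperFilter_ex => P /nbhs_ballP[e /= e0 eP].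
have e2 : 0 < e / 2 by rewrite divr_gt0.
have e2e : e / 2 < e by lra.
have [w /andP[w1 w2]] := cnorm_dense nontriv e2 e2e.
exists w; apply: eP; first by rewrite ball_cnorm /ball_ /= sub0r cnormN.
by rewrite -cnorm_gt0 (lt_trans e2).
Qed.

Lemma deriv_divided_diff A y w f h : w != 0 -> cball y (cnorm w) `<=` A ->
  divided_diff A f y h -> approx A h -> deriv_Cp f y = h y.
Proof.
move=> w0 wA fh hA; have nw0 : 0 < cnorm w by rewrite cnorm_gt0.
have [C C0 hC] := approx_lipschitz w0 wA hA.
rewrite /deriv_Cp; have ? := dnbhs0_proper; apply: (cvg_lim (@cnorm_hausdorff R K)).
apply/cvg_ballP => e e0; rewrite /dnbhs near_withinE.
have d0 : 0 < Num.min (cnorm w) (e / C) by rewrite lt_min nw0 divr_gt0.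
apply/nbhs_ballP; exists (Num.min (cnorm w) (e / C)) => // k.
rewrite !ball_cnorm /ball_ /= sub0r cnormN lt_min => /andP[kw ke] k0.
have yk : y + k - y = k by rewrite addrC addKr.
have -> : (f (y + k) - f y) / k = h (y + k).
  rewrite fh ?yk//; first by apply: wA; rewrite /cball /= yk ltW.
  by rewrite -subr_eq0 yk.
rewrite cnormBC; apply: le_lt_trans (hC _ _) _; rewrite yk ?ltW//.
by move: ke; rewrite ltr_pdivlMr// mulrC.
Qed.

End DividedDifference.

(** * Polynomial approximation on discs and vanishing derivatives *)

Section PolynomialApproximation.
Variables (R : realType) (K : ultraClosedFieldType R).
Implicit Types (A D : set K) (x y z w t : K) (f g h : K -> K) (e d : R) (P Q S : {poly K}).

(** The elements [1 - u] with [cnorm u <= d] are stable under multiplication. *)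
Lemma cnorm_1_sub_prod (I : eqType) (l : seq I) (F : I -> K) d : 0 <= d <= 1 ->
  {in l, forall i, cnorm (F i) <= d} ->
  cnorm (1 - \prod_(i <- l) (1 - F i)) <= d.
Proof.
move=> /andP[d0 d1]; elim: l => [|i l IH] h; first by rewrite big_nil subrr cnorm0.
have {}IH : cnorm (1 - \prod_(i <- l) (1 - F i)) <= d.
  by apply: IH => j jl; apply: h; rewrite inE jl orbT.
rewrite big_cons; set p := \prod_(_ <- _) _ in IH *.
have -> : 1 - (1 - F i) * p = (1 - p) + F i * p by ring.
apply: cnormD_le => //; rewrite cnormM -[leRHS]mulr1; apply: ler_pM; rewrite ?cnorm_ge0//.
  by apply: h; rewrite mem_head.
have -> : p = 1 - (1 - p) by ring.
by apply: cnormB_le; rewrite ?cnorm1// (le_trans IH).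
Qed.

(** The poles avoid the closed disc, so [Q / Q.[y]] is [1 - q] with [q] bounded there by some
    [d < 1]. A truncated geometric series inverts it, with error [g x * q x ^+ N]. *)
Lemma rational_poly_approx y w g e : w != 0 -> rational_on (cball y (cnorm w)) g -> 0 < e ->
  exists P, forall x, cball y (cnorm w) x -> cnorm (g x - P.[x]) <= e.
Proof.
move=> w0 gr e0; have nw0 : 0 < cnorm w by rewrite cnorm_gt0.
have [C hC] := rational_bounded gr nw0 (@subset_refl _ _).
have [P [Q PQ]] := gr; have [l hl] := polyF Q.
have yy : cball y (cnorm w) y by rewrite /cball /= subrr cnorm0 ltW.
have [Qy _] := PQ _ yy.
have far : {in l, forall t, cnorm w < cnorm (y - t)}.
  move=> t tl; rewrite ltNge cnormBC; apply/negP => /PQ[+ _].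
  by rewrite hl (perm_big _ (perm_to_rem tl)) big_cons subrr /= mul0r mulr0 eqxx.
have [d [d0 d1 dl]] : exists d, [/\ 0 <= d, d < 1 & {in l, forall t, cnorm w <= d * cnorm (y - t)}].
  elim: (l) far => [|t l' IH] far; first by exists 0; split=> //; exact: ltr01.
  have [|d [d0 d1 dl]] := IH; first by move=> u ul; apply: far; rewrite inE ul orbT.
  have yt := far t (mem_head _ _); have yt0 := lt_trans nw0 yt.
  exists (Num.max d (cnorm w / cnorm (y - t))); split; first by rewrite le_max d0.
    by rewrite gt_max d1 ltr_pdivrMr// mul1r.
  move=> u; rewrite inE => /orP[/eqP->|ul].
    by rewrite -ler_pdivrMr// le_max lexx orbT.
  apply: le_trans (dl _ ul) _; rewrite ler_wpM2r ?cnorm_ge0//.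
  by rewrite le_max lexx.
pose q x := 1 - Q.[x] / Q.[y].
have qd x : cball y (cnorm w) x -> cnorm (q x) <= d.
  move=> xw; pose F t := (y - x) / (y - t).
  have -> : q x = 1 - \prod_(t <- l) (1 - F t).
    rewrite /q !hl invfM mulrACA divff ?mul1r; last first.
      by move: Qy; rewrite hl mulf_eq0 negb_or => /andP[].
    rewrite -prodfV -big_split /= big_seq [in RHS]big_seq; congr (_ - _).
    apply: eq_bigr => t /far yt; rewrite /F.
    have yt0 : y - t != 0 by rewrite -cnorm_gt0 (lt_trans nw0).
    by field.
  apply: cnorm_1_sub_prod; first by rewrite d0 ltW.
  move=> t tl; have yt := lt_trans nw0 (far _ tl).
  rewrite /F cnormM cnormV ler_pdivrMr// (le_trans _ (dl _ tl))// cnormBC.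
  exact: xw.
pose C1 := Num.max 1 C; have C10 : 0 < C1 by rewrite lt_max ltr01.
have [N hN] : exists n, d ^+ n < e / C1.
  by apply: exprn_lt1_small; rewrite ?d0// divr_gt0.
pose pq := 1 - Q.[y]^-1 *: Q.
exists (Q.[y]^-1 *: (P * \sum_(i < N) pq ^+ i)) => x xw; have [Qx gx] := PQ _ xw.
have pqE : pq.[x] = q x by rewrite /pq /q !hornerE mulrC.
have -> : g x - (Q.[y]^-1 *: (P * \sum_(i < N) pq ^+ i)).[x] = g x * q x ^+ N.
  rewrite !hornerE horner_sum; under eq_bigr do rewrite horner_exp pqE.
  have := subrX1 (q x) N; set s := \sum_(i < N) _ => qN.
  have -> : q x ^+ N = 1 - (Q.[x] / Q.[y]) * s.
    have -> : q x ^+ N = 1 + (q x ^+ N - 1) by ring.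
    by rewrite qN /q; ring.
  by rewrite gx /=; field; rewrite Qx Qy.
rewrite cnormM cnormX; apply: (@le_trans _ _ (C1 * d ^+ N)); last first.
  by move: hN; rewrite ltr_pdivlMr// mulrC => /ltW.
apply: ler_pM; rewrite ?cnorm_ge0 ?exprn_ge0 ?cnorm_ge0//.
  by rewrite le_max hC ?orbT.
by apply: lerXn2r; rewrite ?nnegrE ?cnorm_ge0//; exact: qd.
Qed.

(** The Cauchy inequalities. After subtraction of the constant term, division by [X] costs a factor
    [cnorm w] on the circle, and the maximum principle extends the bound to the disc. *)
Lemma coef_le_sup P w e : w != 0 ->
  (forall x, cnorm x <= cnorm w -> cnorm P.[x] <= e) ->
  forall k, cnorm P`_k * cnorm w ^+ k <= e.
Proof.
move=> w0 + k; have nw0 : 0 < cnorm w by rewrite cnorm_gt0.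
elim: k P e => [|k IH] P e h.
  by rewrite expr0 mulr1 -horner_coef0 h// cnorm0 cnorm_ge0.
have /factor_theorem[S PS] : root (P - P.[0]%:P) 0 by rewrite /root !hornerE subrr.
have ck : P`_k.+1 = S`_k.
  have := congr1 (fun p : {poly K} => p`_k.+1) PS.
  by rewrite subr0 coefMX coefB coefC /= subr0.
have Sx x : x * S.[x] = P.[x] - P.[0].
  by have := congr1 (horner^~ x) PS; rewrite !hornerE subr0 => ->; rewrite mulrC.
rewrite ck exprSr mulrA -ler_pdivlMr//; apply: IH => x xw.
have := @maximum_principle _ _ setT (horner S) 0 w (e / cnorm w) (rational_poly _ _) w0.
apply=> //; last by rewrite subr0.
move=> z; rewrite subr0 => zw; rewrite ler_pdivlMr// -zw -cnormM mulrC Sx.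
by apply: cnormB_le; apply: h; rewrite ?zw ?cnorm0 ?(ltW nw0).
Qed.

Lemma horner_le_coef P w e x : 0 <= e -> cnorm x <= cnorm w ->
  (forall k, (k < size P)%N -> cnorm P`_k.+1 * cnorm w ^+ k.+1 <= e) ->
  cnorm (P.[x] - P.[0]) <= e.
Proof.
(* One term more than [size P] lets the constant term split off even when [P] is zero. *)
move=> e0 xw h; rewrite (horner_coef_wide _ (leqnSn _)) big_ord_recl expr0 mulr1.
rewrite horner_coef0 addrAC subrr add0r.
apply: (big_ind (fun z => cnorm z <= e)) => [|u v|i _]; first by rewrite cnorm0.
  exact: cnormD_le.
apply: le_trans (h i (ltn_ord i)); rewrite cnormM cnormX ler_wpM2l ?cnorm_ge0//.
by apply: lerXn2r; rewrite ?nnegrE ?cnorm_ge0.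
Qed.

(* A small derivative only bounds k times the k-th coefficient of an
   approximant [S1]; the factor k is absorbed by comparing [S1] with a second
   approximant [S2] whose precision depends on the degree of [S1]. *)
Lemma deriv0_constant y w f : (exists w : K, 0 < cnorm w < 1) -> (forall n, n.+1%:R != 0 :> K) ->
  w != 0 -> approx (cball y (cnorm w)) f ->
  (forall x, cball y (cnorm w) x -> deriv_Cp f x = 0) ->
  forall x, cball y (cnorm w) x -> f x = f y.
Proof.
move=> nontriv char0 w0 fA f0; set D := cball y (cnorm w).
have nw0 : 0 < cnorm w by rewrite cnorm_gt0.
have Dy : D y by rewrite /D /cball /= subrr cnorm0 ltW.
have Dsub x : D x -> cball x (cnorm w) `<=` D by move=> xD z zx; apply: (cdist_le zx).
(* The divided difference of [S] at [x] takes the value of its derivative there, and is within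
   [e / cnorm w] of that of [f], whose value at [x] is zero. *)
have deriv_small S e x : 0 < e -> (forall z, D z -> cnorm (f z - S.[z]) <= e) -> D x ->
    cnorm (S^`()).[x] <= e / cnorm w.
  move=> e0 hS xD; have [h [hd hH]] := approx_divided_diff w0 xD (Dsub _ xD) fA.
  have hA := approx_of_divided_diff w0 xD fA hH.
  have hx : h x = 0 by rewrite -(deriv_divided_diff nontriv w0 (Dsub _ xD) hd hA) f0.
  have /factor_theorem[U SU] : root (S - S.[x]%:P) x by rewrite /root !hornerE subrr.
  have -> : (S^`()).[x] = U.[x].
    have := congr1 (fun p : {poly K} => p^`().[x]) SU.
    by rewrite derivB derivC subr0 derivM derivXsubC !hornerE subrr mulr0 add0r.
  have SUd : divided_diff D (horner S) x (horner U).
    move=> z _ zx; have := congr1 (horner^~ z) SU; rewrite !hornerE => ->.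
    by rewrite mulfK// subr_eq0.
  have := hH _ _ _ e0 (rational_poly _ _) (rational_poly _ _) SUd hS _ xD.
  by rewrite hx sub0r cnormN.
pose T S := S \Po ('X + y%:P).
have TE S x : (T S).[x] = S.[x + y] by rewrite horner_comp !hornerE.
have coefT S e k : 0 < e -> (forall z, D z -> cnorm (f z - S.[z]) <= e) ->
    cnorm (k.+1%:R : K) * (cnorm (T S)`_k.+1 * cnorm w ^+ k.+1) <= e.
  move=> e0 hS; have : cnorm ((T S)^`())`_k * cnorm w ^+ k <= e / cnorm w.
    apply: coef_le_sup => // x xw.
    have -> : ((T S)^`()).[x] = (S^`()).[x + y].
      by rewrite deriv_comp derivD derivX derivC addr0 mulr1 TE.
    by apply: deriv_small => //; rewrite /D /cball /= addrK.
  by rewrite coef_deriv -[_`_k.+1 *+ _]mulr_natl cnormM ler_pdivlMr// exprSr !mulrA.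
have small e x : 0 < e -> D x -> cnorm (f x - f y) <= e.
  move=> e0 xD; have [g gr fg] := fA _ e0; have [S1 gS] := rational_poly_approx w0 gr e0.
  have fS1 z : D z -> cnorm (f z - S1.[z]) <= e by move=> zD; apply: (cdist_le (fg _ zD)); exact: gS.
  (* Only finitely many factors [k.+1] occur for [S1], and none is zero in [K]. The second
     approximant is given precision [e * m]. *)
  have [m [m0 m1 hm]] : exists m : R, [/\ 0 < m, m <= 1 &
      forall k, (k < size (T S1))%N -> m <= cnorm (k.+1%:R : K)].
    elim: (size _) => [|n [m [m0 m1 hm]]]; first by exists 1; split.
    exists (Num.min m (cnorm (n.+1%:R : K))); split.
    - by rewrite lt_min m0 cnorm_gt0 char0.
    - by rewrite ge_min m1.
    - move=> k; rewrite ltnS leq_eqVlt => /orP[/eqP->|/hm mk]; first by rewrite ge_min lexx orbT.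
      by rewrite ge_min mk.
  have e20 : 0 < e * m by rewrite mulr_gt0.
  have e2e : e * m <= e by rewrite ger_pMr.
  have [g2 g2r fg2] := fA _ e20; have [S2 gS2] := rational_poly_approx w0 g2r e20.
  have fS2 z : D z -> cnorm (f z - S2.[z]) <= e * m.
    by move=> zD; apply: (cdist_le (fg2 _ zD)); exact: gS2.
  (* The coefficient of [S2] is at most [e] after division by [cnorm k.+1%:R], and that of [S1 - S2]
     is bounded by the Cauchy inequalities. *)
  have ck k : (k < size (T S1))%N -> cnorm (T S1)`_k.+1 * cnorm w ^+ k.+1 <= e.
    move=> ks; have p0 : 0 <= cnorm w ^+ k.+1 by rewrite exprn_ge0// cnorm_ge0.
    have h2 : cnorm (T S2)`_k.+1 * cnorm w ^+ k.+1 <= e.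
      have nk := lt_le_trans m0 (hm k ks).
      rewrite -(ler_pM2l nk); apply: le_trans (coefT _ _ k e20 fS2) _.
      by rewrite mulrC ler_wpM2r ?hm// ltW.
    have h12 : cnorm (T S1 - T S2)`_k.+1 * cnorm w ^+ k.+1 <= e.
      apply: coef_le_sup => // z zw; rewrite hornerD hornerN !TE.
      have zD : D (z + y) by rewrite /D /cball /= addrK.
      apply: (@cdist_le _ _ (f (z + y))); first by rewrite cnormBC fS1.
      exact: le_trans (fS2 _ zD) e2e.
    have q0 : 0 < cnorm w ^+ k.+1 by rewrite exprn_gt0.
    rewrite -ler_pdivlMr//; rewrite -ler_pdivlMr// in h2; rewrite -ler_pdivlMr// in h12.
    rewrite -[(T S1)`__](subrK (T S2)`_k.+1) -coefB; exact: cnormD_le.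
  have S1x : cnorm (S1.[x] - S1.[y]) <= e.
    have -> : S1.[x] = (T S1).[x - y] by rewrite TE subrK.
    have -> : S1.[y] = (T S1).[0] by rewrite TE add0r.
    by apply: horner_le_coef ck => //; exact: ltW.
  apply: (@cdist_le _ _ S1.[x]); first exact: fS1.
  by apply: (@cdist_le _ _ S1.[y]) => //; rewrite cnormBC fS1.
move=> x xD; apply/eqP; rewrite -subr_eq0 -cnorm_eq0E eq_le cnorm_ge0 andbT.
by apply/ler_addgt0Pl => e e0; rewrite addr0; exact: small.
Qed.

End PolynomialApproximation.

(** * Injective functions on an affinoid *)

Section InjectiveHolomorphic.
Variables (R : realType) (K : ultraClosedFieldType R).
Implicit Types (A : set K) (x y z w t u v : K) (f g h : K -> K).
Hypothesis nontriv : exists w : K, 0 < cnorm w < 1.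
Hypothesis char0 : forall n, n.+1%:R != 0 :> K.

Lemma eq_circle_invariant A (u v : K -> R) : (forall z, A z -> u z = v z) ->
  circle_invariant A v -> circle_invariant A u.
Proof.
move=> uv h z1 z2 [D1 D2]; have [->//|z12] := eqVneq z1 z2.
have r0 : 0 < cnorm (z1 - z2) by rewrite cnorm_gt0 subr_eq0.
by rewrite !uv; [apply: h|apply/D2/oballxx|apply/D1/oballxx].
Qed.

Lemma eq_annulus_power A (u v : K -> R) : (forall z, A z -> u z = v z) ->
  annulus_power A v -> annulus_power A u.
Proof.
move=> uv h x z1 z2 adj; have [/andP[r0 _] _ _ _] := adj.
have [C [a [b E]]] := h _ _ _ adj; exists C, a, b => z rz gz; rewrite -E// uv//.
by apply/gz/oballxx; case/andP: rz => + _; apply: lt_le_trans.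
Qed.

Lemma divided_diff_deriv A f y d : oball y d `<=` A -> 0 < d -> approx A f ->
  exists h, [/\ divided_diff A f y h, approx A h & h y = deriv_Cp f y].
Proof.
move=> yA d0 fA; have d2 : d / 2 < d by lra.
have d20 : 0 < d / 2 by lra.
have [w /andP[w1 wd]] := cnorm_dense nontriv d20 d2.
have w0 : w != 0 by rewrite -cnorm_gt0 (lt_trans d20).
have wA : cball y (cnorm w) `<=` A by move=> z zy; apply/yA/(le_lt_trans zy).
have Ay : A y by apply/yA/oballxx.
have [h [hd hH]] := approx_divided_diff w0 Ay wA fA.
have hA := approx_of_divided_diff w0 Ay fA hH.
by exists h; split=> //; rewrite (deriv_divided_diff nontriv w0 wA hd hA).
Qed.

(* [cnorm (deriv_Cp f x)] takes a single nonzero value at the points of the disc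
   where it does not vanish. If [deriv_Cp f y = 0], such points still accumulate
   at [y], which contradicts the continuity of the divided difference. *)
Lemma injective_deriv_neq0 A f y d : oball y d `<=` A -> 0 < d -> approx A f ->
  (forall x x', A x -> A x' -> f x = f x' -> x = x') -> deriv_Cp f y != 0.
Proof.
move=> yA d0 fA0 inj0; pose D := oball y d.
have fA : approx D f := approx_sub yA fA0.
have inj x x' : D x -> D x' -> f x = f x' -> x = x'.
  by move=> /yA Ax /yA Ax'; exact: inj0.
have Dy : D y by apply: oballxx.
(* By injectivity and the condition at [x], the divided difference at [x] has no zero in [D], so its
   modulus is constant. *)
have scale x x' : D x -> D x' -> deriv_Cp f x != 0 ->
    cnorm (f x' - f x) = cnorm (x' - x) * cnorm (deriv_Cp f x).
  move=> Dx Dx' fx; have [->|xx'] := eqVneq x' x; first by rewrite !subrr cnorm0 mul0r.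
  have De : oball x d `<=` D by rewrite /D (oball_recenter Dx).
  have [h [hd hA hx]] := divided_diff_deriv De d0 fA.
  have : cnorm (h x') = cnorm (h x).
    apply: (constant_on_disc nontriv hA) => // z Dz.
    have [->|zx] := eqVneq z x; first by rewrite hx.
    rewrite hd// mulf_neq0 ?invr_eq0 ?subr_eq0//.
    by apply: contra_neq zx; exact: inj.
  rewrite hx hd// cnormM cnormV => <-; rewrite mulrC divfK// cnorm_eq0E subr_eq0.
  exact: xx'.
apply/eqP => fy0.
have [h [hd hA hy]] := divided_diff_deriv (@subset_refl _ D) d0 fA.
have small_disc (r : R) : 0 < r -> exists w, [/\ w != 0, cnorm w < r & cnorm w < d].
  move=> r0; have m0 : 0 < Num.min r d by rewrite lt_min r0.
  have m2 : Num.min r d / 2 < Num.min r d by lra.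
  have m20 : 0 < Num.min r d / 2 by lra.
  have [w /andP[w1]] := cnorm_dense nontriv m20 m2.
  rewrite lt_min => /andP[? ?]; exists w; split=> //.
  by rewrite -cnorm_gt0 (lt_trans m20).
(* Otherwise [f] would be constant on a small disc, against injectivity. *)
have nonzero w : w != 0 -> cnorm w < d ->
    exists x, cnorm (x - y) <= cnorm w /\ deriv_Cp f x != 0.
  move=> w0 wd; apply: contrapT => no.
  have wD : cball y (cnorm w) `<=` D by move=> z zy; apply: le_lt_trans wd.
  have yw : cball y (cnorm w) (y + w) by rewrite /cball /= addrAC subrr add0r.
  have /inj : f (y + w) = f y.
    apply: (deriv0_constant nontriv char0 w0 (approx_sub wD fA)) => // x xw.
    by apply/eqP; apply: contrapT => /negP fx; apply: no; exists x.
  move=> /(_ (wD _ yw) Dy) e; move: w0.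
  by rewrite -[w](addKr y) e addNr eqxx.
have [w1 [w10 _ w1d]] := small_disc _ d0.
have w1D : cball y (cnorm w1) `<=` D by move=> z zy; apply: le_lt_trans w1d.
have [C C0 hC] := approx_lipschitz w10 w1D hA.
have [x1 [x1w fx1]] := nonzero _ w10 w1d; have Dx1 := w1D _ x1w.
have c0 : 0 < cnorm (deriv_Cp f x1) by rewrite cnorm_gt0.
(* The radius is so small that the Lipschitz bound forces [cnorm (h x2) < cnorm (deriv_Cp f x1)],
   whereas [scale] gives equality. *)
have [w2 [w20]] := small_disc (Num.min (cnorm w1) (cnorm (deriv_Cp f x1) / C))
  ltac:(by rewrite lt_min cnorm_gt0 w10 divr_gt0).
rewrite lt_min => /andP[w21 w2C] w2d.
have [x2 [x2w fx2]] := nonzero _ w20 w2d.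
have x2w1 : cnorm (x2 - y) <= cnorm w1 by apply: (le_trans x2w); exact: ltW.
have Dx2 := w1D _ x2w1.
have x2y : x2 != y by apply: contraNneq fx2 => ->; rewrite fy0.
have n2 : cnorm (x2 - y) != 0 by rewrite cnorm_eq0E subr_eq0.
have e12 : cnorm (deriv_Cp f x2) = cnorm (deriv_Cp f x1).
  have [->//|x12] := eqVneq x1 x2.
  have n12 : cnorm (x1 - x2) != 0 by rewrite cnorm_eq0E subr_eq0.
  apply: (mulfI n12); rewrite -(scale x2 x1)// cnormBC (scale x1 x2)//.
  by rewrite cnormBC.
have := hC _ x2w1; rewrite hy fy0 subr0 hd// cnormM cnormV cnormBC (scale x2 y)//.
rewrite cnormBC mulrAC divff// mul1r e12; apply/negP; rewrite -ltNge.
by apply: le_lt_trans (_ : C * cnorm w2 < _); [rewrite ler_pM2l|rewrite mulrC -ltr_pdivlMr].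
Qed.

Lemma injective_affinoid A f x y : affinoid A -> approx A f ->
  (forall x x', A x -> A x' -> f x = f x' -> x = x') -> A x -> A y -> x != y ->
  cnorm ((f x - f y) / (x - y)) ^+ 2 = cnorm (deriv_Cp f x * deriv_Cp f y).
Proof.
move=> aff fA inj Ax Ay xy.
pose M (u v : K) := if u == v then cnorm (deriv_Cp f u) else cnorm ((f u - f v) / (u - v)).
have package (v : K) : A v -> exists h, [/\ approx A h, forall u, A u -> h u != 0 & forall u, A u -> M u v = cnorm (h u)].
  move=> Av; have [d d0 dA] := affinoid_open aff Av.
  have [h [hd hA hv]] := divided_diff_deriv dA d0 fA.
  exists h; split=> // u Au; have [->|uv] := eqVneq u v.
  - by rewrite hv; exact: injective_deriv_neq0 dA d0 fA inj.
  - rewrite hd// mulf_neq0 ?invr_eq0 ?subr_eq0//.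
    by apply: contra_neq uv; exact: inj.
  - by rewrite /M eqxx hv.
  - by rewrite /M (negbTE uv) hd.
have Msym (u v : K) : M u v = M v u.
  rewrite /M eq_sym; have [->//|_] := eqVneq v u.
  by rewrite -[f u - f v]opprB -[u - v]opprB invrN mulrNN.
have Mpos (u v : K) : A u -> A v -> 0 < M u v.
  by move=> Au /package[h [_ h0 ->//]]; rewrite cnorm_gt0 h0.
have Mcirc (v : K) : A v -> circle_invariant A (M^~ v).
  move=> /package[h [hA h0 hM]]; apply: (eq_circle_invariant hM).
  exact: nonvanishing_circle.
have Mann (v : K) : A v -> annulus_power A (M^~ v).
  move=> /package[h [hA h0 hM]]; apply: (eq_annulus_power hM).
  exact: nonvanishing_annulus.
have := symmetric_cross_ratio nontriv Mpos Msym Mcirc Mann aff Ax Ay Ay Ax.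
by rewrite (Msym y x) /M !eqxx (negbTE xy) => e; rewrite expr2 e cnormM.
Qed.

End InjectiveHolomorphic.

(** * Nontriviality of the norm and characteristic zero *)

Section PadicHypotheses.
Variables (R : realType) (K : ultraClosedFieldType R) (p : nat).
Hypotheses (p_pr : prime p) (KCp : is_Cp K p).

Lemma cnorm_nat n : (0 < n)%N -> cnorm (n%:R : K) = (p%:R ^+ logn p n)^-1.
Proof.
move=> n0; have [+ _] := KCp => /(_ n%:Z%:~R).
rewrite ratr_int -pmulrn => ->; rewrite /padic_norm intr_eq0 numq_int denq_int /=.
by rewrite logn1 expr0 div1r eqz_nat eqn0Ngt n0.
Qed.

Lemma cnorm_nontrivial : exists w : K, 0 < cnorm w < 1.
Proof.
exists p%:R; rewrite cnorm_nat ?prime_gt0// logn_prime// eqxx expr1.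
have p1 : 1 < p%:R :> R by rewrite ltr1n prime_gt1.
by rewrite invr_gt0 invf_lt1 (lt_trans ltr01 p1).
Qed.

Lemma natr_neq0 n : n.+1%:R != 0 :> K.
Proof.
by rewrite -cnorm_gt0 cnorm_nat// invr_gt0 exprn_gt0// ltr0n prime_gt0.
Qed.

End PadicHypotheses.

(** * From holomorphic functions on affinoids to analytic spaces *)

Lemma holomorphic_approx (R : realType) (K : ultraClosedFieldType R) (A : set K) (f : K -> K) :
  holomorphic_on_affinoid A f -> approx A f.
Proof.
move=> [g [gr gf]] e e0.
have [|N _ gN] := gf [set h | forall z, A z -> ball (f z) e (h z)].
  apply/uniform_nbhs; exists [set xy | ball xy.1 e xy.2]; split=> //.
  by rewrite -entourage_ballE; exists e.
exists (g N) => [|z Az]; first exact: gr.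
by have := gN N (leqnn N) z Az; rewrite ball_cnorm => /ltW.
Qed.

Unset Implicit Arguments.

Theorem mainTheorem1 (R : realType) (p : nat) (K : ultraClosedFieldType R)
    (X : set K) (f : K -> K) :
  prime p -> is_Cp K p -> analytic_space X -> holomorphic X f ->
  ~ (exists c : K, forall x, X x -> f x = c) ->
  {in X &, injective f} <->
  (forall x y, X x -> X y -> x != y ->
     cnorm ((f x - f y) / (x - y)) ^+ 2 = cnorm (deriv_Cp f x * deriv_Cp f y)).
Proof.
move=> p_pr KCp [An [Aff Amono XE]] fX nonconst; split=> [inj x y Xx Xy xy|H x y].
  (* The union is increasing, so one affinoid contains both points and the equation needs to be
     proved only there. *)
  have [n [Ax Ay]] : exists n, An n x /\ An n y.
    move: Xx Xy; rewrite XE => -[i _ Ax] [j _ Ay]; exists (maxn i j).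
    by split; [apply: (Amono i)|apply: (Amono j)]; rewrite ?leq_maxl ?leq_maxr.
  have AX : An n `<=` X by move=> z Az; rewrite XE; exists n.
  apply: (injective_affinoid (cnorm_nontrivial p_pr KCp) (natr_neq0 p_pr KCp) (Aff n)) => //.
    exact/holomorphic_approx/fX.
  by move=> u v /AX Xu /AX Xv; apply: inj; rewrite inE.
have critical z : X z -> deriv_Cp f z = 0 -> exists c, forall x, X x -> f x = c.
  move=> Xz fz; exists (f z) => t Xt; have [->//|tz] := eqVneq t z.
  have := H _ _ Xt Xz tz; rewrite fz mulr0 cnorm0 => /eqP.
  rewrite expf_eq0 /= cnorm_eq0E mulf_eq0 invr_eq0 !subr_eq0 (negbTE tz) orbF.
  by move/eqP.
rewrite !inE => Xx Xy fxy; apply: contrapT => /eqP xy; apply: nonconst.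
have := H _ _ Xx Xy xy; rewrite fxy subrr mul0r cnorm0 expr0n => /esym/eqP.
rewrite cnorm_eq0E mulf_eq0 => /orP[] /eqP; exact: critical.
Qed.
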